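(* Let $q\in[1,+\infty)$. Let $d,m,N$ be positive integers, $0<\Lambda_1<\dots<\Lambda_N$ real numbers, $A_1,\dots,A_N$ real $d\times d$ matrices, $B$ a real $d\times m$ matrix and $g\in L^\infty([0,\Lambda_N],\mathbb{R}^{d\times d})$. Consider the input-output system $$\begin{cases} x(t)=\sum_{j=1}^NA_jx(t-\Lambda_j)+\int_0^{\Lambda_N} g(s)x(t-s)\,ds+Bu(t),& t\ge \inf \mathrm{supp}(u),\\ x(t)=0,& t<\inf \mathrm{supp}(u),\\ y(t)=x(t-\Lambda_N),& t\in[0,+\infty),\end{cases}$$ with input $u\in(\Omega_q)^m$ and output $y$, interpreted as the pseudo-rational system of order zero $\Sigma^Q$ associated with $$Q:=\delta_{-\Lambda_N} I_d- \sum_{j=1}^N \delta_{-\Lambda_N+\Lambda_j} A_j- \delta_{-\Lambda_N}*\tilde g,\qquad P:=B\delta_0,$$ where $\tilde g$ is the extension of $g$ to $\mathbb{R}$ by zero. Then this system is $X^{Q,q}$ quasi-reachable (resp. $X^{Q,q}$ reachable) if and only if it is $X^{Q,q}$ quasi-reachable (resp. $X^{Q,q}$ reachable) in time $\widetilde T$ for all $\widetilde T>d\Lambda_N$. In particular, if the system is $X^{Q,q}$ quasi-reachable (resp. $X^{Q,q}$ reachable), an upper bound on the minimal time of quasi-reachability $T^{\rm qr}_{\min,q}$ (resp. of reachability $T^{\rm r}_{\min,q}$) is given by $d\Lambda_N$.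
   Context: Notation: $\mathbb{R}_-=(-\infty,0]$, $\mathbb{R}_+=[0,+\infty)$; $*$ denotes convolution; $\delta_t$ is the Dirac distribution at $t$; $I_d$ is the identity matrix. $M(\mathbb{R}_-)$ is the space of distributions of order zero (Radon measures) on $\mathbb{R}$ with compact support contained in $\mathbb{R}_-$. $M_+(\mathbb{R})$ is the space of distributions of order zero (Radon measures) on $\mathbb{R}$ with support bounded on the left. Truncation: for a function $f$ on $\mathbb{R}$, $\pi(f):=f_{|\mathbb{R}_+}$. For a distribution $\alpha\in\mathcal{D}'(\mathbb{R})$, $\pi\alpha$ is the restriction of $\alpha$ to test functions in $\mathcal{D}(\mathbb{R}_+)$, the infinitely differentiable functions on $\mathbb{R}$ with compact support contained in $\mathbb{R}_+$. These operations are applied entrywise. Function spaces, for $q\in[1,+\infty)$: $\Omega_q:=\bigcup_{i\ge1}L^q([-i,0],\mathbb{R})$, whose elements are regarded as functions on $\mathbb{R}$ vanishing outside a compact subset of $\mathbb{R}_-$; $\Gamma_q:=L^q_{\rm loc}(\mathbb{R}_+,\mathbb{R})$, with the Fréchet topology given by the $L^q$ seminorms on compact intervals (and the product topology on $(\Gamma_q)^d$). Elements of $\Gamma_q$ are extended by zero to $\mathbb{R}$ when convolved. A pseudo-rational system of order zero $\Sigma^Q$ is given by a $d\times d$ matrix $Q$ and a $d\times m$ matrix $P$ with entries in $M(\mathbb{R}_-)$ such that there is a $d\times d$ matrix $Q^{-1}$ with entries in $M_+(\mathbb{R})$ satisfying $Q^{-1}*Q=Q*Q^{-1}=\delta_0I_d$;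 its input-output relation is $y=\pi(Q^{-1}*P*u)$, with $u\in(\Omega_q)^m$ and $y\in(\Gamma_q)^d$. The matrix $Q$ in the claim is invertible over $M_+(\mathbb{R})$ in this sense. The state space is $X^{Q,q}:=\{y\in(\Gamma_q)^d \mid \pi(Q*y)=0\}$. The system is: - $X^{Q,q}$ quasi-reachable if for all $y\in X^{Q,q}$ there is a sequence $(u_n)_{n\in\mathbb{N}}$ in $(\Omega_q)^m$ with $\pi(Q^{-1}*P*u_n)\to y$ in $(L^q_{\rm loc}(\mathbb{R}_+,\mathbb{R}))^d$ as $n\to+\infty$; - $X^{Q,q}$ quasi-reachable in time $T>0$ if the same holds with each $u_n$ supported in $[-T,0]$; - $X^{Q,q}$ reachable if for all $y\in X^{Q,q}$ there is $u\in(\Omega_q)^m$ with $\pi(Q^{-1}*P*u)=y$; - $X^{Q,q}$ reachable in time $T>0$ if the same holds with $u$ supported in $[-T,0]$. The minimal times $T^{\rm qr}_{\min,q}$ and $T^{\rm r}_{\min,q}$ are the infima of the $T>0$ such that the system is $X^{Q,q}$ quasi-reachable in time $T$, respectively $X^{Q,q}$ reachable in time $T$. *)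

(* Defs.v *)
From HB Require Import structures.
From mathcomp Require Import all_boot all_order all_algebra.
From mathcomp Require Import all_classical all_reals all_analysis.
From mathcomp Require Import measurable_realfun ess_sup_inf lra.

Set Implicit Arguments.
Unset Strict Implicit.
Unset Printing Implicit Defensive.

Import Order.TTheory GRing.Theory Num.Theory.
Import numFieldNormedType.Exports.

Local Open Scope classical_set_scope.
Local Open Scope ring_scope.

(* L^p([a, b]): functions are total representatives, of which only the values
   on [a, b] matter; [f \_ D] is the extension by zero of the restriction of f
   to D. *)
Definition in_Lp {R : realType} (p : \bar R) (a b : R) (f : R -> R) : Prop :=
  f \_ `[a, b] \in Lfun lebesgue_measure p.

Section PositiveRadon.
Context {R : realType}.
Local Open Scope ereal_scope.

(* Positive Radon measures on R with support bounded on the left. *)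
Record pradon := PRadon {
  pr_measure : {measure set R -> \bar R} ;
  pr_locfin : forall a b : R, pr_measure `[a, b]%classic < +oo ;
  pr_left : exists a : R, pr_measure `]-oo, a[%classic = 0 }.

Definition pr_set (p : pradon) : set R -> \bar R := pr_measure p.

HB.instance Definition _ (p : pradon) := Measure.on (pr_set p).

Lemma pr_sigma_finite (p : pradon) : sigma_finite setT (pr_set p).
Proof.
exists (fun n : nat => `[(- n%:R)%R, n%:R]%classic : set R).
  apply/seteqP; split => // x _.
  exists (Num.bound `|x|%R) => //=; rewrite in_itv/= -ler_norml.
  exact/ltW/archi_boundP.
by move=> n; split; [exact: measurable_itv | exact: pr_locfin].
Qed.

HB.instance Definition _ (p : pradon) :=
  @Measure_isSigmaFinite.Build _ _ _ (pr_set p) (pr_sigma_finite p).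

Lemma pr_setS (p : pradon) (A B : set R) :
  measurable A -> measurable B -> A `<=` B -> pr_set p A <= pr_set p B.
Proof. by move=> mA mB AB; apply: le_measure => //; rewrite inE. Qed.

Lemma pr_set0S (p : pradon) (A B : set R) :
  measurable A -> measurable B -> A `<=` B -> pr_set p B = 0 -> pr_set p A = 0.
Proof.
move=> mA mB AB pB; apply/eqP; rewrite eq_le measure_ge0 andbT.
by rewrite -pB; exact: pr_setS.
Qed.

Lemma pr_left2 (p1 p2 : pradon) : exists a : R,
  pr_set p1 `]-oo, a[%classic = 0 /\ pr_set p2 `]-oo, a[%classic = 0.
Proof.
have [a1 h1] := pr_left p1; have [a2 h2] := pr_left p2.
exists (Num.min a1 a2); split.
  apply: (pr_set0S _ _ _ h1); rewrite ?measurable_itv// => x /=.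
  by rewrite !in_itv/= lt_min => /andP[].
apply: (pr_set0S _ _ _ h2); rewrite ?measurable_itv// => x /=.
by rewrite !in_itv/= lt_min => /andP[].
Qed.

Lemma mzero_left : exists a : R, @mzero _ R R `]-oo, a[%classic = 0.
Proof. by exists 0%R. Qed.

Definition pr_zero : pradon := @PRadon mzero (fun a b => ltry 0) mzero_left.

Lemma dirac_locfin (t a b : R) : \d_t `[a, b]%classic < +oo :> \bar R.
Proof. by rewrite diracE ltry. Qed.

Lemma dirac_left (t : R) : exists a : R, \d_t `]-oo, a[%classic = 0 :> \bar R.
Proof. by exists t; rewrite diracE memNset//= in_itv/= ltxx. Qed.

Definition pr_dirac (t : R) : pradon :=
  @PRadon (dirac t) (dirac_locfin t) (dirac_left t).

Lemma pr_add_locfin (p1 p2 : pradon) (a b : R) :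
  measure_add (pr_set p1) (pr_set p2) `[a, b]%classic < +oo.
Proof. by rewrite measure_addE lte_add_pinfty//; exact: pr_locfin. Qed.

Lemma pr_add_left (p1 p2 : pradon) :
  exists a : R, measure_add (pr_set p1) (pr_set p2) `]-oo, a[%classic = 0.
Proof.
have [a [h1 h2]] := pr_left2 p1 p2.
by exists a; rewrite measure_addE [X in X + _]h1 add0e; exact: h2.
Qed.

Definition pr_add (p1 p2 : pradon) : pradon :=
  PRadon (pr_add_locfin p1 p2) (pr_add_left p1 p2).

Lemma pr_addE (p1 p2 : pradon) (A : set R) :
  pr_set (pr_add p1 p2) A = pr_set p1 A + pr_set p2 A.
Proof. exact: measure_addE. Qed.

Lemma pr_scale_locfin (c : {nonneg R}) (p : pradon) (a b : R) :
  mscale c (pr_set p) `[a, b]%classic < +oo.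
Proof. by rewrite /mscale/= lte_mul_pinfty ?lee_fin//; exact: pr_locfin. Qed.

Lemma pr_scale_left (c : {nonneg R}) (p : pradon) :
  exists a : R, mscale c (pr_set p) `]-oo, a[%classic = 0.
Proof.
have [a h] := pr_left p.
by exists a; rewrite /mscale [X in _ * X]h mule0.
Qed.

Definition pr_scale (c : {nonneg R}) (p : pradon) : pradon :=
  PRadon (pr_scale_locfin c p) (pr_scale_left c p).

Lemma pr_scaleE (c : {nonneg R}) (p : pradon) (A : set R) :
  pr_set (pr_scale c p) A = c%:num%:E * pr_set p A.
Proof. by []. Qed.

Definition add_pair (z : R * R) : R := (z.1 + z.2)%R.

Lemma measurable_add_pair : measurable_fun setT add_pair.
Proof. exact: measurable_funD. Qed.

(* The convolution of measures is the image of the product measure under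
   addition. *)
Definition pr_conv_set (p1 p2 : pradon) : set R -> \bar R :=
  pushforward (pr_set p1 \x pr_set p2) add_pair.

Let mpre (A : set R) : measurable A -> measurable (add_pair @^-1` A).
Proof.
by move=> mA; rewrite -[X in measurable X]setTI; exact: measurable_add_pair.
Qed.

Let conv0 (p1 p2 : pradon) : pr_conv_set p1 p2 set0 = 0.
Proof. by rewrite /pr_conv_set /pushforward preimage_set0; exact: measure0. Qed.

Let conv_ge0 (p1 p2 : pradon) A : 0 <= pr_conv_set p1 p2 A.
Proof. by rewrite /pr_conv_set /pushforward; exact: measure_ge0. Qed.

Let conv_sigma_additive (p1 p2 : pradon) :
  semi_sigma_additive (pr_conv_set p1 p2).
Proof.
move=> F mF tF mUF; rewrite /pr_conv_set /pushforward preimage_bigcup.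
apply: measure_semi_sigma_additive.
- by move=> n; exact: mpre.
- apply/trivIsetP => /= i j _ _ ij; rewrite -preimage_setI.
  by move/trivIsetP : tF => /(_ _ _ _ _ ij) ->//; rewrite preimage_set0.
- by rewrite -preimage_bigcup; exact: mpre.
Qed.

HB.instance Definition _ (p1 p2 : pradon) := isMeasure.Build _ _ _
  (pr_conv_set p1 p2) (conv0 p1 p2) (@conv_ge0 p1 p2)
  (@conv_sigma_additive p1 p2).

Let prodE (p1 p2 : pradon) (A B : set R) : measurable A -> measurable B ->
  (pr_set p1 \x pr_set p2) (A `*` B) = pr_set p1 A * pr_set p2 B.
Proof. by move=> mA mB; rewrite product_measure1E. Qed.

Let preimage_itv_null (p1 p2 : pradon) (a1 a2 : R) :
  pr_set p1 `]-oo, a1[%classic = 0 -> pr_set p2 `]-oo, a2[%classic = 0 ->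
  (pr_set p1 \x pr_set p2) (`]-oo, a1[ `*` setT `|` setT `*` `]-oo, a2[) = 0.
Proof.
move=> h1 h2.
apply/eqP; rewrite eq_le measure_ge0 andbT.
apply: (le_trans (measureU2 _ _ _)); [exact: measurableX..|].
by rewrite [X in X + _]prodE// [X in _ + X]prodE// h1 h2 mul0e mule0 adde0.
Qed.

Lemma pr_conv_left (p1 p2 : pradon) :
  exists a : R, pr_conv_set p1 p2 `]-oo, a[%classic = 0.
Proof.
have [a1 h1] := pr_left p1; have [a2 h2] := pr_left p2.
exists (a1 + a2)%R; apply/eqP; rewrite eq_le measure_ge0 andbT.
rewrite -(preimage_itv_null h1 h2).
apply: (@le_measure _ _ _ (pr_set p1 \x pr_set p2)); rewrite ?inE.
- by apply: mpre; exact: measurable_itv.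
- by apply: measurableU; exact: measurableX.
- move=> [x y]; rewrite /add_pair/= !in_itv/= => xy.
  have [xa|ax] := ltP x a1; first by left; split => //=; rewrite ?in_itv/= ?xa ?ya.
  by right; split => //=; rewrite ?in_itv/=; move: xy ax; lra.
Qed.

Lemma pr_conv_locfin (p1 p2 : pradon) (a b : R) :
  pr_conv_set p1 p2 `[a, b]%classic < +oo.
Proof.
have [a1 h1] := pr_left p1; have [a2 h2] := pr_left p2.
pose E : set (R * R) := `[a1, (b - a2)%R]%classic `*` `[a2, (b - a1)%R]%classic.
pose N : set (R * R) := `]-oo, a1[ `*` setT `|` setT `*` `]-oo, a2[.
have mE : measurable E by exact: measurableX.
have mN : measurable N by apply: measurableU; exact: measurableX.
apply: (@le_lt_trans _ _ ((pr_set p1 \x pr_set p2) (N `|` E))).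
  apply: (@le_measure _ _ _ (pr_set p1 \x pr_set p2)); rewrite ?inE.
  - by apply: mpre; exact: measurable_itv.
  - exact: measurableU.
  - move=> [x y]; rewrite /add_pair/= !in_itv/= => /andP[axy xyb].
    have [xa|ax] := ltP x a1; first by left; left; split => //=; rewrite ?in_itv/= ?xa ?ya.
    have [ya|ay] := ltP y a2; first by left; right; split => //=; rewrite ?in_itv/= ?xa ?ya.
    by right; split; rewrite /= ?in_itv/=; apply/andP; split => //; lra.
apply: (le_lt_trans (measureU2 _ _ _)) => //.
rewrite [X in X + _](preimage_itv_null h1 h2) add0e [X in X < _]prodE//.
by rewrite lte_mul_pinfty//; [rewrite ge0_fin_numE//|]; exact: pr_locfin.
Qed.

Definition pr_conv (p1 p2 : pradon) : pradon :=
  PRadon (pr_conv_locfin p1 p2) (pr_conv_left p1 p2).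

End PositiveRadon.
Arguments pradon R : clear implicits.

(* For f >= 0 in L^oo([0, L]), the measure whose density with respect to the
   Lebesgue measure is the extension of f by zero. *)
Section Density.
Context {R : realType}.
Variables (L : R) (f : R -> R).
Hypotheses (f0 : forall x, 0 <= f x) (hf : in_Lp +oo%E 0 L f).
Local Open Scope ereal_scope.

Let h : R -> R := f \_ `[0%R, L].

Let mh : measurable_fun setT h.
Proof. by have /sub_Lfun_mfun := hf; rewrite inE. Qed.

Let h0 x : (0 <= h x)%R.
Proof. by rewrite /h patchE; case: ifP. Qed.

Definition density_set (A : set R) : \bar R :=
  \int[lebesgue_measure]_(x in A) (h x)%:E.

Let density0 : density_set set0 = 0.
Proof. exact: integral_set0. Qed.

Let density_ge0 A : 0 <= density_set A.
Proof. by apply: integral_ge0 => x _; rewrite lee_fin. Qed.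

Let density_sigma_additive : semi_sigma_additive density_set.
Proof.
have nng := @semi_sigma_additive_nng_induced _ _ _ lebesgue_measure (EFin \o h).
by apply: nng => [|x]; [exact/measurable_EFinP | rewrite lee_fin].
Qed.

HB.instance Definition _ := isMeasure.Build _ _ _ density_set
  density0 density_ge0 density_sigma_additive.

Lemma density_left : exists a : R, density_set `]-oo, a[%classic = 0.
Proof.
exists 0%R; apply: integral0_eq => x /=; rewrite in_itv/= => x0.
by rewrite /h patchE memNset//= in_itv/= leNgt x0.
Qed.

Lemma density_locfin (a b : R) : density_set `[a, b]%classic < +oo.
Proof.
have /sub_Lfun_finLfun := hf; rewrite inE /= /finite_norm unlock/=.
have -> : 0 < lebesgue_measure [set: R].
  by rewrite -set_itvNyy lebesgue_measure_itv/= ltry.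
set M := ess_sup _ _ => Moo.
have [c [c0 Mc]] : exists c : R, (0 <= c)%R /\ M <= c%:E.
  case: M Moo => [r| |] // _; last by exists 0%R; rewrite leNye.
  by exists `|r|%R; split=> //; rewrite lee_fin ler_norm.
apply: (@le_lt_trans _ _ (\int[lebesgue_measure]_(x in `[a, b]) (cst c%:E) x)).
  apply: ae_ge0_le_integral => //=.
  - by move=> x _; rewrite lee_fin.
  - exact/measurable_funTS/measurable_EFinP.
  - have /ess_supP := Mc; apply: filterS => x /= hx _.
    by apply: le_trans hx; rewrite lee_fin ler_norm.
by rewrite integral_cst//= lebesgue_measure_itv/=; case: ifP => _;
  rewrite ?mule0// -EFinB -EFinM ltry.
Qed.

Definition pr_density : pradon R := PRadon density_locfin density_left.

End Density.

Section RadonAlgebra.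
Context {R : realType}.

(* Real Radon measures (distributions of order zero) on R with support bounded
   on the left, i.e. M_+(R), as differences of two positive ones; two such
   differences are compared with [mradon_eq], not with Leibniz equality. *)
Record mradon := MRadon { mr_pos : pradon R ; mr_neg : pradon R }.

(* mr_pos a - mr_neg a = mr_pos b - mr_neg b. As the four measures are
   sigma-finite, testing on all Borel sets, with values in [0, +oo], amounts to
   testing on the bounded ones. *)
Definition mradon_eq (a b : mradon) : Prop :=
  forall A : set R, measurable A ->
    (pr_set (mr_pos a) A + pr_set (mr_neg b) A =
     pr_set (mr_pos b) A + pr_set (mr_neg a) A)%E.

(* The support of a is contained in the closed set D. *)
Definition mr_supported (D : set R) (a : mradon) : Prop :=
  forall A : set R, measurable A -> A `&` D = set0 ->
    pr_set (mr_pos a) A = pr_set (mr_neg a) A.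

(* Membership in M(R_-). *)
Definition in_MRminus (a : mradon) : Prop :=
  exists l : R, mr_supported `[l, 0] a.

Definition mr_zero : mradon := MRadon pr_zero pr_zero.

Definition mr_dirac (t : R) : mradon := MRadon (pr_dirac t) pr_zero.

Definition mr_add (a b : mradon) : mradon :=
  MRadon (pr_add (mr_pos a) (mr_pos b)) (pr_add (mr_neg a) (mr_neg b)).

Definition mr_opp (a : mradon) : mradon := MRadon (mr_neg a) (mr_pos a).

Definition mr_sub (a b : mradon) : mradon := mr_add a (mr_opp b).

Definition mr_scale (c : R) (a : mradon) : mradon :=
  let ca := MRadon (pr_scale `|c|%:nng (mr_pos a))
                   (pr_scale `|c|%:nng (mr_neg a)) in
  if 0 <= c then ca else mr_opp ca.

Definition mr_conv (a b : mradon) : mradon :=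
  MRadon (pr_add (pr_conv (mr_pos a) (mr_pos b))
                 (pr_conv (mr_neg a) (mr_neg b)))
         (pr_add (pr_conv (mr_pos a) (mr_neg b))
                 (pr_conv (mr_neg a) (mr_pos b))).

Lemma in_Loo_le (L : R) (f g : R -> R) :
  measurable_fun setT (g \_ `[0, L]) -> (forall x, `|g x| <= `|f x|) ->
  in_Lp +oo%E 0 L f -> in_Lp +oo%E 0 L g.
Proof.
move=> mg gf /andP[_]; rewrite inE/= => foo; apply/andP; split.
  by rewrite inE.
rewrite inE/=; apply: le_lt_trans foo; rewrite unlock; case: ifP => // _.
apply: le_ess_sup; apply/nearW => x /=; rewrite lee_fin !patchE.
by case: ifP => // _; rewrite normr0.
Qed.

Lemma in_Lp_funrpos (L : R) (f : R -> R) :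
  in_Lp +oo%E 0 L f -> in_Lp +oo%E 0 L f^\+.
Proof.
move=> hf; apply: (in_Loo_le _ _ hf) => [|x].
  have /sub_Lfun_mfun := hf; rewrite inE => /measurable_funrpos.
  congr measurable_fun; apply/funext => x; rewrite /funrpos !patchE.
  by case: ifP => // _; rewrite maxxx.
by rewrite ger0_norm ?funrpos_ge0// /funrpos ge_max normr_ge0 ler_norm.
Qed.

Lemma in_Lp_funrneg (L : R) (f : R -> R) :
  in_Lp +oo%E 0 L f -> in_Lp +oo%E 0 L f^\-.
Proof.
move=> hf; apply: (in_Loo_le _ _ hf) => [|x].
  have /sub_Lfun_mfun := hf; rewrite inE => /measurable_funrneg.
  congr measurable_fun; apply/funext => x; rewrite /funrneg !patchE.
  by case: ifP => // _; rewrite oppr0 maxxx.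
by rewrite ger0_norm ?funrneg_ge0// /funrneg ge_max normr_ge0 -normrN ler_norm.
Qed.

(* The extension by zero of f in L^oo([0, L]), as a measure. *)
Definition mr_density (L : R) (f : R -> R) (hf : in_Lp +oo%E 0 L f) : mradon :=
  MRadon (pr_density (funrpos_ge0 f) (in_Lp_funrpos hf))
         (pr_density (funrneg_ge0 f) (in_Lp_funrneg hf)).

(* a * f, for f : R -> R of L^q_loc with support bounded on the left; both
   integrals are finite for almost every t. *)
Definition mr_convf (a : mradon) (f : R -> R) (t : R) : R :=
  \int[pr_set (mr_pos a)]_s f (t - s) - \int[pr_set (mr_neg a)]_s f (t - s).

Definition mr_sum (n : nat) (F : 'I_n -> mradon) : mradon :=
  \big[mr_add/mr_zero]_(k < n) F k.

(* The constant matrix C times the scalar measure a. *)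
Definition mx_scale (n p : nat) (C : 'M[R]_(n, p)) (a : mradon) :
    'M[mradon]_(n, p) :=
  \matrix_(i, j) mr_scale (C i j) a.

Definition mx_conv (n p r : nat) (M : 'M[mradon]_(n, p))
    (M' : 'M[mradon]_(p, r)) : 'M[mradon]_(n, r) :=
  \matrix_(i, j) mr_sum (fun k => mr_conv (M i k) (M' k j)).

Definition mx_eq (n p : nat) (M M' : 'M[mradon]_(n, p)) : Prop :=
  forall i j, mradon_eq (M i j) (M' i j).

Definition mx_convf (n p : nat) (M : 'M[mradon]_(n, p)) (f : 'I_p -> R -> R) :
    'I_n -> R -> R :=
  fun i t => \sum_(k < p) mr_convf (M i k) (f k) t.

End RadonAlgebra.
Arguments mradon R : clear implicits.

Section System.
Context {R : realType}.

Definition Rplus : set R := `[0, +oo[.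

(* pi, on functions; f|R_+ is identified with its extension by zero. *)
Definition trunc (n : nat) (f : 'I_n -> R -> R) : 'I_n -> R -> R :=
  fun i => f i \_ Rplus.

Definition supported_in (n : nat) (a b : R) (u : 'I_n -> R -> R) : Prop :=
  forall i t, ~ `[a, b]%classic t -> u i t = 0.

(* (Omega_q)^n *)
Definition Omega (q : R) (n : nat) (u : 'I_n -> R -> R) : Prop :=
  exists k : nat, (forall i, in_Lp q%:E (- k%:R) 0 (u i)) /\
    supported_in (- k%:R) 0 u.

(* (Gamma_q)^n; only the values on R_+ matter. *)
Definition Gamma (q : R) (n : nat) (y : 'I_n -> R -> R) : Prop :=
  forall i (T : R), 0 <= T -> in_Lp q%:E 0 T (y i).

Definition Gamma_eq (n : nat) (y z : 'I_n -> R -> R) : Prop :=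
  forall i, ae_eq lebesgue_measure Rplus (y i) (z i).

(* Convergence of the sequence y_ to y in (Gamma_q)^n. *)
Definition Gamma_cvg (q : R) (n : nat) (y_ : nat -> 'I_n -> R -> R)
    (y : 'I_n -> R -> R) : Prop :=
  forall i (T : R), 0 <= T ->
    Lnorm lebesgue_measure q%:E (EFin \o ((y_ k i \- y i) \_ `[0, T]))
      @[k --> \oo] --> 0%E.

Section Fixed.
Variables (d m : nat) (Q : 'M[mradon R]_d) (P : 'M[mradon R]_(d, m)).

(* (Q, P) defines a pseudo-rational system of order zero, and Qinv is the
   inverse of Q over M_+(R). *)
Definition pseudo_rational (Qinv : 'M[mradon R]_d) : Prop :=
  [/\ forall i j, in_MRminus (Q i j),
      forall i j, in_MRminus (P i j),
      mx_eq (mx_conv Qinv Q) (mx_scale 1%:M (mr_dirac 0)) &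
      mx_eq (mx_conv Q Qinv) (mx_scale 1%:M (mr_dirac 0))].

(* X^{Q, q} *)
Definition state_space (q : R) (y : 'I_d -> R -> R) : Prop :=
  Gamma q y /\ Gamma_eq (trunc (mx_convf Q (trunc y))) (fun _ _ => 0).

Variable Qinv : 'M[mradon R]_d.

Definition output (u : 'I_m -> R -> R) : 'I_d -> R -> R :=
  trunc (mx_convf Qinv (mx_convf P u)).

Definition quasi_reachable (q : R) : Prop :=
  forall y, state_space q y ->
  exists u_ : nat -> 'I_m -> R -> R,
    (forall k, Omega q (u_ k)) /\ Gamma_cvg q (fun k => output (u_ k)) y.

Definition quasi_reachable_in (q T : R) : Prop :=
  forall y, state_space q y ->
  exists u_ : nat -> 'I_m -> R -> R,
    (forall k, Omega q (u_ k) /\ supported_in (- T) 0 (u_ k)) /\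
    Gamma_cvg q (fun k => output (u_ k)) y.

Definition reachable (q : R) : Prop :=
  forall y, state_space q y ->
  exists u, Omega q u /\ Gamma_eq (output u) y.

Definition reachable_in (q T : R) : Prop :=
  forall y, state_space q y ->
  exists u, [/\ Omega q u, supported_in (- T) 0 u & Gamma_eq (output u) y].

(* Minimal times; the infimum of the empty set is +oo. *)
Definition Tmin_qr (q : R) : \bar R :=
  ereal_inf [set T%:E | T in [set T | 0 < T /\ quasi_reachable_in q T]].

Definition Tmin_r (q : R) : \bar R :=
  ereal_inf [set T%:E | T in [set T | 0 < T /\ reachable_in q T]].

End Fixed.

(* The matrices Q and P of the delay system
   x(t) = sum_j A_j x(t - Lam_j) + int_0^L g(s) x(t - s) ds + B u(t),
   y(t) = x(t - L), where L is the largest delay; the N.+1 delays are indexed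
   from 0. *)
Definition delay_Q (d N : nat) (Lam : 'I_N.+1 -> R) (A : 'I_N.+1 -> 'M[R]_d)
    (g : R -> 'M[R]_d)
    (hg : forall i j, in_Lp +oo%E 0 (Lam ord_max) (fun s => g s i j)) :
    'M[mradon R]_d :=
  let L := Lam ord_max in
  \matrix_(i, j)
    mr_sub
      (mr_sub (mx_scale 1%:M (mr_dirac (- L)) i j)
              (mr_sum (fun k => mx_scale (A k) (mr_dirac (- L + Lam k)) i j)))
      (mr_conv (mr_dirac (- L)) (mr_density (hg i j))).

Definition delay_P (d m : nat) (B : 'M[R]_(d, m)) : 'M[mradon R]_(d, m) :=
  mx_scale B (mr_dirac 0).

Let pr_null (a b : R) (p : pradon R) := forall A : set R, measurable A ->
  A `&` `[a, b] = set0 -> pr_set p A = 0%E.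

Let mr_null (a b : R) (x : mradon R) :=
  pr_null a b (mr_pos x) /\ pr_null a b (mr_neg x).

Let mr_null_supported a b x : mr_null a b x -> mr_supported `[a, b] x.
Proof. by move=> [xp xn] A mA A0; rewrite xp ?xn. Qed.

Let pr_null_sub a b a' b' p : a' <= a -> b <= b' ->
  pr_null a b p -> pr_null a' b' p.
Proof.
move=> aa bb pn A mA A0; apply: pn => //; apply/seteqP; split => // x [Ax].
rewrite /= in_itv/= => /andP[ax xb].
have : (A `&` `[a', b']) x.
  by split => //=; rewrite in_itv/= (le_trans aa ax) (le_trans xb bb).
by rewrite A0.
Qed.

Let pr_null_zero a b : pr_null a b pr_zero.
Proof. by []. Qed.

Let pr_null_dirac a b t : a <= t <= b -> pr_null a b (pr_dirac t).
Proof.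
move=> tab A mA A0; rewrite /pr_set/= diracE memNset// => At.
by have : (A `&` `[a, b]) t by []; rewrite A0.
Qed.

Let pr_null_add a b p1 p2 : pr_null a b p1 -> pr_null a b p2 ->
  pr_null a b (pr_add p1 p2).
Proof.
by move=> h1 h2 A mA A0; rewrite pr_addE h1// h2// adde0.
Qed.

Let pr_null_scale a b c p : pr_null a b p -> pr_null a b (pr_scale c p).
Proof.
by move=> h A mA A0; rewrite pr_scaleE h// mule0.
Qed.

Let pr_null_conv a b a' b' p1 p2 : pr_null a b p1 -> pr_null a' b' p2 ->
  pr_null (a + a') (b + b') (pr_conv p1 p2).
Proof.
move=> h1 h2 A mA A0; rewrite /pr_set/= /pr_conv_set /pushforward.
apply/eqP; rewrite eq_le measure_ge0 andbT.
pose N : set (R * R) := (~` `[a, b]) `*` setT `|` setT `*` (~` `[a', b']).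
have mN1 : measurable (~` `[a, b]%classic : set R) by exact: measurableC.
have mN2 : measurable (~` `[a', b']%classic : set R) by exact: measurableC.
have mN : measurable N by apply: measurableU; exact: measurableX.
have N0 : ((pr_set p1 \x pr_set p2) N <= 0)%E.
  apply: (le_trans (measureU2 _ _ _)); [exact: measurableX..|].
  rewrite [X in (X + _)%E](product_measure1E _ _ mN1 measurableT).
  rewrite [X in (_ + X)%E](product_measure1E _ _ measurableT mN2).
  rewrite [X in (X * _ + _)%E]h1 ?setICl// [X in (_ + _ * X)%E]h2 ?setICl//.
  by rewrite mul0e mule0 adde0.
apply: le_trans N0.
apply: (@le_measure _ _ _ (pr_set p1 \x pr_set p2)%E); rewrite ?inE//.
  by rewrite -[X in measurable X]setTI; apply: measurable_add_pair.
move=> [x y] /= Axy.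
have [xab|xab] := pselect (`[a, b]%classic x); last by left.
have [yab|yab] := pselect (`[a', b']%classic y); last by right.
exfalso; suff : (A `&` `[a + a', b + b']) (x + y) by rewrite A0.
split => //; move: xab yab; rewrite /= !in_itv/= => /andP[? ?] /andP[? ?].
by rewrite !lerD.
Qed.

Let pr_null_density L f f0 hf : pr_null 0 L (@pr_density R L f f0 hf).
Proof.
move=> A mA A0; apply: integral0_eq => x Ax; rewrite patchE memNset// => xL.
by have : (A `&` `[0, L]) x by []; rewrite A0.
Qed.

Let mr_null_zero a b : mr_null a b mr_zero.
Proof. by split; exact: pr_null_zero. Qed.

Let mr_null_add a b x y : mr_null a b x -> mr_null a b y ->
  mr_null a b (mr_add x y).
Proof. by move=> [? ?] [? ?]; split; exact: pr_null_add. Qed.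

Let mr_null_opp a b x : mr_null a b x -> mr_null a b (mr_opp x).
Proof. by move=> []. Qed.

Let mr_null_scale a b c x : mr_null a b x -> mr_null a b (mr_scale c x).
Proof.
by move=> [? ?]; rewrite /mr_scale; case: ifP => _; split; exact: pr_null_scale.
Qed.

Let mr_null_dirac a b t : a <= t <= b -> mr_null a b (mr_dirac t).
Proof. by move=> h; split; [exact: pr_null_dirac|exact: pr_null_zero]. Qed.

Let mr_null_conv a b a' b' x y : mr_null a b x -> mr_null a' b' y ->
  mr_null (a + a') (b + b') (mr_conv x y).
Proof.
by move=> [? ?] [? ?]; split; apply: pr_null_add; exact: pr_null_conv.
Qed.

Lemma delay_Q_MRminus (d N : nat) (Lam : 'I_N.+1 -> R) (A : 'I_N.+1 -> 'M[R]_d)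
    (g : R -> 'M[R]_d)
    (hg : forall i j, in_Lp +oo%E 0 (Lam ord_max) (fun s => g s i j)) :
  0 < Lam ord0 -> (forall k l : 'I_N.+1, (k < l)%N -> Lam k < Lam l) ->
  forall i j, in_MRminus (delay_Q A hg i j).
Proof.
move=> Lam0 Lamlt i j; exists (- Lam ord_max); apply: mr_null_supported.
have Lamge k : 0 <= Lam k.
  have [->|k0] := eqVneq k ord0; first exact: ltW.
  by rewrite ltW// (lt_trans Lam0)// Lamlt// lt0n.
have Lamle k : Lam k <= Lam ord_max.
  have [->//|km] := eqVneq k ord_max.
  by rewrite ltW// Lamlt// ltn_neqAle km/= -ltnS.
rewrite !mxE; apply: mr_null_add; [apply: mr_null_add|apply: mr_null_opp].
- rewrite ?mxE; apply: mr_null_scale; apply: mr_null_dirac.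
  by rewrite lexx oppr_le0 Lamge.
- apply: mr_null_opp; rewrite /mr_sum.
  elim/big_rec: _ => [|k x _ hx]; first exact: mr_null_zero.
  apply: mr_null_add => //; rewrite ?mxE; apply: mr_null_scale; apply: mr_null_dirac.
  by rewrite lerDl Lamge addrC subr_le0 Lamle.
- have := @mr_null_conv (- Lam ord_max) (- Lam ord_max) 0 (Lam ord_max)
    (mr_dirac (- Lam ord_max)) (mr_density (hg i j)).
  rewrite addr0 addNr; apply; first by apply: mr_null_dirac; rewrite lexx.
  by split; exact: pr_null_density.
Qed.

Lemma delay_P_MRminus (d m : nat) (B : 'M[R]_(d, m)) :
  forall i j, in_MRminus (delay_P B i j).
Proof.
move=> i j; exists 0; apply: mr_null_supported; rewrite mxE.
by apply: mr_null_scale; apply: mr_null_dirac; rewrite lexx.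
Qed.

End System.

(* Main.v *)
Require Import Defs.
From HB Require Import structures.
From mathcomp Require Import all_boot all_order all_algebra.
From mathcomp Require Import all_classical all_reals all_analysis.
From mathcomp Require Import measurable_realfun ring lra.
Import Order.TTheory GRing.Theory Num.Theory.
Import numFieldNormedType.Exports.
Local Open Scope classical_set_scope.
Local Open Scope ring_scope.
Set Implicit Arguments.
Unset Strict Implicit.
Unset Printing Implicit Defensive.

(* With L the largest delay, the adjugate identity [\adj Q * Q = \det Q]
   in the commutative algebra M_+(R) shows that every input u can be replaced,
   without any change of the output on R_+, by an input u' supported in
   [-dL, 0].  Indeed let [w = (\det Q)^-1 * u], let w' be the restriction of w to
   R_+ and [u' = \det Q * w'].  Since [\det Q] is supported in [-dL, 0], u' vanishes
   on ]-oo, -dL[, and on ]0, +oo[ it coincides with [\det Q * w = u = 0].  The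
   outputs of u and u' are [\adj Q * P * w] and [\adj Q * P * w'], which coincide
   on R_+ because [\adj Q * P] is supported in R_- and w = w' on R_+. *)

(** The adjugate identity lives in a commutative ring, but a [mradon] is a pair of positive measures
    up to [mradon_eq], and its convolution with a function is finite only almost everywhere.
    Measures are therefore identified when they act alike, almost everywhere, on locally integrable
    functions with left-bounded support. Apart from commutativity of the product, the ring laws come
    from addition and composition of operators. Supports become statements about where images
    vanish; these pass through sums and products, hence through determinants and adjugates. The
    inverse of [\det Q] is [\det Qinv]. The factor d counts the entries of Q in a term of the
    Leibniz formula, each reaching back by at most L. The cut is made on w rather than on u because
    the support of [Qinv] may extend to the right of 0, so that [Qinv * P] need not preserve
    vanishing on R_+, whereas [\det Q * Qinv = \adj Q] does. *)

Section Translation.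
Context {R : realType}.
Local Notation mu := (@lebesgue_measure R).
Local Open Scope ereal_scope.

Lemma measurable_subr (s : R) : measurable_fun setT (fun t : R => (t - s)%R).
Proof. exact: measurable_funB. Qed.

Definition subr_mfun (s : R) : {mfun measurableTypeR R >-> measurableTypeR R} :=
  HB.pack (fun t : R => (t - s)%R)
    (isMeasurableFun.Build _ _ (measurableTypeR R) (measurableTypeR R) _
      (measurable_subr s)).

(** Uniqueness of the Lebesgue measure reduces translation invariance to half-open intervals. *)
Lemma lebesgue_measure_subr (s : R) (A : set R) : measurable A ->
  mu A = pushforward mu (subr_mfun s) A.
Proof.
apply: (@lebesgue_measure_unique R (pushforward mu (subr_mfun s))).
move=> _ [[a b] _ <-] /=.
rewrite /pushforward.
have -> : subr_mfun s @^-1` `]a, b] = `](a + s)%R, (b + s)%R]%classic.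
  by apply/seteqP; split => x /=; rewrite !in_itv/= ltrBrDr lerBlDr.
rewrite !lebesgue_measure_itv/= !lte_fin ltrD2r; case: ifP => // _.
by rewrite -!EFinB; congr _%:E; ring.
Qed.

Lemma ge0_integral_subr (s : R) (h : R -> \bar R) :
  measurable_fun setT h -> (forall t, 0 <= h t) ->
  \int[mu]_t h (t - s)%R = \int[mu]_t h t.
Proof.
move=> mh h0; transitivity (\int[pushforward mu (subr_mfun s)]_t h t).
  by rewrite ge0_integral_pushforward.
apply: eq_measure_integral => A mA _.
exact/esym/lebesgue_measure_subr.
Qed.

End Translation.

(** * Local finiteness of convolutions by Tonelli's theorem *)

Section Tonelli.
Context {R : realType}.
Local Notation mu := (@lebesgue_measure R).
Local Open Scope ereal_scope.
Implicit Types (p : pradon R) (h : R -> R).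

Lemma measurable_sub_pair : measurable_fun setT (fun z : R * R => (z.1 - z.2)%R).
Proof. exact: measurable_funB. Qed.

Lemma measurable_comp_sub h : measurable_fun setT h ->
  measurable_fun setT (fun z : R * R => h (z.1 - z.2)%R).
Proof.
move=> mh; apply: (@measurableT_comp _ _ _ _ _ _ h) => //.
exact: measurable_sub_pair.
Qed.

Lemma measurable_comp_subl h (t : R) : measurable_fun setT h ->
  measurable_fun setT (fun s : R => h (t - s)%R).
Proof.
by move=> mh; apply: (@measurableT_comp _ _ _ _ _ _ h) => //; exact: measurable_funB.
Qed.

Lemma measurable_conv_integral p h : measurable_fun setT h ->
  (forall t, (0 <= h t)%R) ->
  measurable_fun setT (fun t : R => \int[pr_set p]_s (h (t - s)%R)%:E).
Proof.
move=> mh h0.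
apply: (measurable_fun_fubini_tonelli_F
  (fun z : R * R => (h (z.1 - z.2)%R)%:E)) => [|z].
  apply/measurable_EFinP. exact (measurable_comp_sub mh).
by rewrite lee_fin.
Qed.

(** Exchanging the integrals turns the left-hand side into the integral of G(b - s) against p, where
    G is the primitive of h. Left-bounded supports confine s to a compact interval, which has finite
    mass. *)
Lemma conv_integral_lty p h (c : R) : measurable_fun setT h ->
  (forall t, (0 <= h t)%R) -> (forall t, (t < c)%R -> h t = 0%R) ->
  (forall b, \int[mu]_(t in `]-oo, b]) (h t)%:E < +oo) ->
  forall b, \int[mu]_(t in `]-oo, b]) \int[pr_set p]_s (h (t - s)%R)%:E < +oo.
Proof.
move=> mh h0 hc hoo b.
pose G (x : R) := \int[mu]_(t in `]-oo, x]) (h t)%:E.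
have [a pa] := pr_left p.
pose f (z : R * R) := (\1_(`]-oo, b]%classic) z.1 * h (z.1 - z.2)%R)%:E.
have mf : measurable_fun setT f.
  apply/measurable_EFinP/measurable_funM; last exact (measurable_comp_sub mh).
  have m1 : measurable_fun setT (\1_(`]-oo, b]%classic) : R -> R) by [].
  exact (measurableT_comp m1 measurable_fst).
have f0 z : 0 <= f z by rewrite lee_fin mulr_ge0.
have E1 : \int[mu]_(t in `]-oo, b]) \int[pr_set p]_s (h (t - s)%R)%:E =
    \int[mu]_t \int[pr_set p]_s f (t, s).
  rewrite integral_mkcond; apply: eq_integral => t _.
  rewrite patchE /f/= indicE; case: ifPn => tb.
    by apply: eq_integral => s _; rewrite mul1r.
  by under eq_integral do rewrite mul0r; rewrite integral0.
have E2 (s : R) : \int[mu]_t f (t, s) = G (b - s)%R.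
  rewrite /G [RHS]integral_mkcond -[RHS](ge0_integral_subr s).
  - apply: eq_integral => t _; rewrite /f/= patchE indicE !mem_setE !in_itv/=.
    by rewrite lerD2r; case: ifP => _; rewrite ?mul1r ?mul0r.
  - apply/(measurable_restrictT _ _).1 => //.
    exact/measurable_funTS/measurable_EFinP.
  - by move=> t; rewrite erestrict_ge0// => x _; rewrite lee_fin.
have G0 (x : R) : 0 <= G x by apply: integral_ge0 => t _; rewrite lee_fin.
have -> : \int[mu]_(t in `]-oo, b]) \int[pr_set p]_s (h (t - s)%R)%:E =
    \int[pr_set p]_s G (b - s)%R.
  rewrite E1; transitivity (\int[pr_set p]_s \int[mu]_t f (t, s)).
    exact (@fubini_tonelli _ _ (measurableTypeR R) _ R mu (pr_set p) f mf f0).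
  exact: eq_integral.
pose D : set R := `[a, (b - c)%R]%classic.
have mD : measurable D by exact: measurable_itv.
(* The part s < a is null for p; for s > b - c the half-line ]-oo, b - s] lies below c, where h
   vanishes; in between, G is bounded by its value at b - a. *)
apply: (@le_lt_trans _ _ (\int[pr_set p]_s (G (b - a)%R * (\1_D s)%:E))).
  apply: ae_ge0_le_integral => //.
  - by rewrite -(_ : (fun s => \int[mu]_t f (t, s)) = (fun s => G (b - s)%R));
      [exact (@measurable_fun_fubini_tonelli_G _ _ (measurableTypeR R) _ R mu f
         mf f0)|apply/funext].
  - by move=> s _; rewrite mule_ge0// lee_fin.
  - by apply: emeasurable_funM => //; apply/measurable_EFinP; exact: measurable_indic.
  - exists `]-oo, a[%classic; split => // s /=; rewrite in_itv/=.
    apply: contra_notT; rewrite -leNgt => sa _.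
    rewrite indicE mem_setE in_itv/= sa/=; have [sbc|sbc] := leP s (b - c)%R.
      rewrite mule1; apply: ge0_subset_integral => //.
      - exact/measurable_funTS/measurable_EFinP.
      - by move=> t _; rewrite lee_fin.
      - by move=> t /=; rewrite !in_itv/= => /le_trans; apply; rewrite lerD2l lerN2.
    rewrite mule0 /G integral0_eq// => t /=; rewrite in_itv/= => tb.
    by rewrite hc//; move: tb sbc; lra.
rewrite ge0_integralZl//; last exact/measurable_EFinP.
rewrite integral_indic// setIT lte_mul_pinfty//; last exact: pr_locfin.
rewrite ge0_fin_numE//; exact: hoo.
Qed.

End Tonelli.

(** * A power-mean inequality *)

Section PowerMean.
Context d (T : measurableType d) {R : realType}.
Variable m : {measure set T -> \bar R}.
Local Open Scope ereal_scope.

(** Hölder's inequality for g 1_D and 1_D with exponents q and q / (q - 1). The case q = 1, whose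
    conjugate exponent is infinite, is treated apart. *)
Lemma le_poweR_integral (q : R) (D : set T) (g : T -> R) : (1 <= q)%R ->
  measurable D -> measurable_fun setT g -> (forall x, (0 <= g x)%R) ->
  {ae m, forall x, ~ D x -> g x = 0%R} ->
  (\int[m]_x (g x)%:E) `^ q <= (m D) `^ (q - 1) * \int[m]_x (g x `^ q)%:E.
Proof.
move=> q1 mD mg g0 gD.
have q0 : (0 < q)%R := lt_le_trans ltr01 q1.
have [->|qn1] := eqVneq q 1%R.
  rewrite subrr poweRe0 mul1e poweRe1; last first.
    by apply: integral_ge0 => x _; rewrite lee_fin.
  by under [leRHS]eq_integral do rewrite powRr1//.
have qlt : (1 < q)%R by rewrite lt_neqAle eq_sym qn1.
have qm1 : (0 < q - 1)%R by rewrite subr_gt0.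
have mgq : measurable_fun setT (fun x => (g x `^ q)%:E).
  by apply/measurable_EFinP; exact: measurableT_comp (measurable_powR _) mg.
pose h x := (g x * \1_D x)%R.
have mh : measurable_fun setT h.
  by apply: measurable_funM => //; exact: measurable_indic.
have := @hoelder _ _ _ m h (\1_D) q (q / (q - 1)) mh _ q0.
have -> : (h \* \1_D)%R = h.
  by apply/funext => x /=; rewrite /h indicE -mulrA -natrM mulnb andbb.
have m1 : measurable_fun setT (\1_D : T -> R) by exact: measurable_indic.
rewrite Lnorm1 => /(_ m1).
have -> : \int[m]_x `|(EFin \o h) x| = \int[m]_x (g x)%:E.
  apply: ge0_ae_eq_integral => //=.
  - by do 2 apply: measurableT_comp => //.
  - exact/measurable_EFinP.
  - by move=> x _; rewrite lee_fin.
  - apply: filterS gD => x gx _; rewrite /h indicE.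
    have [xD|/negP xD] := boolP (x \in D).
      by rewrite mulr1 ger0_norm.
    by rewrite mulr0 normr0 gx// => Dx; apply: xD; rewrite inE.
move=> /(_ (divr_gt0 q0 qm1)) H.
have {}H : \int[m]_x (g x)%:E <=
    'N[m]_q%:E[EFin \o h] * 'N[m]_(q / (q - 1))%:E[EFin \o \1_D].
  by apply: H; rewrite invf_div; field; rewrite !gt_eqF.

have int0 : 0 <= \int[m]_x (g x)%:E by apply: integral_ge0 => x _; rewrite lee_fin.
have ey (x : \bar R) : 0 <= x -> x \in `[0, +oo] by move=> x0; rewrite in_itv/= x0 leey.
apply: (le_trans (gt0_ler_poweR (ltW q0) _ _ H)).
- exact: ey.
- by apply: ey; rewrite mule_ge0// Lnorm_ge0.
rewrite poweRM ?Lnorm_ge0// poweR_Lnorm ?gt_eqF// muleC.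
have q1q : (0 < q / (q - 1))%R by rewrite divr_gt0.
have -> : 'N[m]_(q / (q - 1))%:E[EFin \o \1_D] `^ q = (m D) `^ (q - 1).
  (* Writing the outer exponent as a multiple of the conjugate exponent lets [poweR_Lnorm] apply.
     The rewriting also hits the inner occurrences of q, which are folded back below. *)
  have -> : q = (q / (q - 1) * (q - 1))%R by field; rewrite gt_eqF.
  rewrite poweRrM.
  have -> : (q / (q - 1) * (q - 1) / (q / (q - 1) * (q - 1) - 1) = q / (q - 1))%R.
    by field; rewrite !gt_eqF.
  rewrite poweR_Lnorm ?gt_eqF//; congr (_ `^ _); last by field; rewrite gt_eqF.
  rewrite -[RHS](_ : \int[m]_x (\1_D x)%:E = _); last by rewrite integral_indic// setIT.
  apply: eq_integral => x _ /=; rewrite indicE; case: (x \in D) => /=.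
    by rewrite normr1 powR1.
  by rewrite normr0 powR0// gt_eqF.
apply: lee_wpmul2l; first exact: poweR_ge0.
apply: ge0_le_integral => //=.
- apply/measurable_EFinP; apply: (@measurableT_comp _ _ _ _ _ _ (@powR R ^~ q)) => //.
  exact: measurableT_comp.
- move=> x _; rewrite lee_fin; apply: ge0_ler_powR; rewrite ?nnegrE ?(ltW q0)//.
  rewrite /h indicE normrM ger0_norm//.
  case: (x \in D); rewrite ?normr1 ?normr0 ?mulr1//.
  by rewrite mulr0.
Qed.
End PowerMean.

(** * Locally L^q functions and their convolution with positive measures *)

Section Lqloc.
Context {R : realType}.
Local Notation mu := (@lebesgue_measure R).
Implicit Types (p : pradon R) (f g : R -> R) (q : R).

(* Since the support is bounded on the left, integrability on the half-lines
   ]-oo, b] is local integrability. *)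
Definition Lqloc q f : Prop :=
  [/\ measurable_fun setT f,
      exists c, forall t, t < c -> f t = 0 &
      forall b, (\int[mu]_(t in `]-oo, b]) (`|f t| `^ q)%:E < +oo)%E].

Definition pr_convf p f (t : R) : R := \int[pr_set p]_s f (t - s).

Lemma measurable_normr_powR q f : measurable_fun setT f ->
  measurable_fun setT (fun t => `|f t| `^ q).
Proof.
move=> mf; apply: (@measurableT_comp _ _ _ _ _ _ (@powR R ^~ q)) => //.
exact: measurableT_comp.
Qed.

(** On ]-oo, b], |f| is at most the indicator of [c, b] plus |f|^q. *)
Lemma Lqloc_sub1 q f : 1 <= q -> Lqloc q f -> Lqloc 1 f.
Proof.
move=> q1 [mf [c fc] fq]; split => // [|b]; first by exists c.
have q0 : 0 < q := lt_le_trans ltr01 q1.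
under eq_integral do rewrite powRr1//.
apply: (@le_lt_trans _ _ (\int[mu]_(t in `]-oo, b])
    ((\1_(`[c, b]%classic) t)%:E + (`|f t| `^ q)%:E))%E).
  apply: ge0_le_integral => //=.
  - by apply/measurable_EFinP/measurable_funTS; exact: measurableT_comp.
  - apply: measurable_funTS; apply: emeasurable_funD.
      by apply/measurable_EFinP; exact: measurable_indic.
    apply/measurable_EFinP; exact (measurable_normr_powR q mf).
  - move=> t; rewrite in_itv/= => tb; rewrite -EFinD lee_fin indicE.
    rewrite mem_setE in_itv/= tb andbT.
    have [ct|tc] := leP c t; last by rewrite fc// normr0 add0r powR_ge0.
    have [f1|f1] := leP 1 `|f t|.
      by rewrite (le_trans (le1r_powR f1 q1))// lerDr.
    by rewrite (le_trans (ltW f1))// lerDl powR_ge0.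
rewrite ge0_integralD//=.
- rewrite lte_add_pinfty// integral_indic//.
  rewrite (@le_lt_trans _ _ (mu `[c, b]))//.
    by apply: (@le_measure _ _ _ mu); rewrite ?inE//; exact: measurableI.
  by rewrite lebesgue_measure_itv/=; case: ifP => _; rewrite -?EFinD ltry.
- by apply/measurable_EFinP; exact: measurable_indic.
- by apply/measurable_EFinP/measurable_funTS; exact (measurable_normr_powR q mf).
Qed.

Lemma Lqloc_conv_lty p q f b : 0 < q -> Lqloc q f ->
  (\int[mu]_(t in `]-oo, b]) \int[pr_set p]_s (`|f (t - s)| `^ q)%:E < +oo)%E.
Proof.
move=> q0 [mf [c fc] fq].
apply: (@conv_integral_lty _ p (fun t => `|f t| `^ q) c) => //.
- exact: measurable_normr_powR.
- by move=> t tc; rewrite fc// normr0 powR0// gt_eqF.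
Qed.

(** The convolution of p with |f| is integrable on each half-line ]-oo, n], hence finite almost
    everywhere there; the countably many exceptional sets are then united. *)
Lemma ae_pr_integrable p f : Lqloc 1 f ->
  {ae mu, forall t, (pr_set p).-integrable setT (fun s => (f (t - s))%:E)}.
Proof.
move=> Vf; have [mf [c fc] _] := Vf.
have H (n : nat) : {ae mu, forall t, `]-oo, n%:R]%classic t ->
    (\int[pr_set p]_s `|f (t - s)|%:E)%E \is a fin_num}.
  apply: (integrable_ae (mu := mu)) => //.
  apply/integrableP; split.
    apply: measurable_funTS.
    apply: (@measurable_conv_integral _ p (fun t => `|f t|)) => //.
    exact: measurableT_comp.
  have := @Lqloc_conv_lty p 1 f n%:R ltr01 Vf; apply: le_lt_trans.
  rewrite le_eqVlt; apply/orP; left; apply/eqP; apply: eq_integral => t _.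
  rewrite gee0_abs; last by apply: integral_ge0 => s _; rewrite lee_fin.
  by apply: eq_integral => s _; rewrite powRr1.
have := ae_foralln H; apply: filterS => t /= Ht.
apply/integrableP; split.
  apply/measurable_EFinP; exact (measurable_comp_subl t mf).
have : `]-oo, (Num.bound `|t|)%:R]%classic t.
  by rewrite /= in_itv/= (le_trans (ler_norm t))// ltW// archi_boundP.
by move=> /Ht; rewrite ge0_fin_numE//; apply: integral_ge0 => s _; rewrite lee_fin.
Qed.

Lemma measurable_pr_convf p f : measurable_fun setT f ->
  measurable_fun setT (pr_convf p f).
Proof.
move=> mf; rewrite /pr_convf /Rintegral.
apply: (measurableT_comp (fine_measurable _)) => //=.
rewrite (_ : (fun _ => _) = (fun t : R =>
  \int[pr_set p]_s (f^\+ (t - s))%:E - \int[pr_set p]_s (f^\- (t - s))%:E)%E).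
  by apply: emeasurable_funB; apply: measurable_conv_integral => //;
    [exact: measurable_funrpos|exact: measurable_funrneg].
apply/funext => t; rewrite integralE; congr (_ - _)%E; apply: eq_integral => s _.
  by rewrite funeposE /funrpos EFin_max.
by rewrite funenegE /funrneg EFin_max.
Qed.

Lemma pr_convf_left p f (a c t : R) : measurable_fun setT f ->
  pr_set p `]-oo, a[%classic = 0%E ->
  (forall t, t < c -> f t = 0) -> t < c + a -> pr_convf p f t = 0.
Proof.
move=> mf pa fc tca; rewrite /pr_convf /Rintegral.
rewrite (ae_eq_integral (cst 0%E)) ?integral0//.
  by apply/measurable_EFinP; exact: measurable_comp_subl.
exists `]-oo, a[%classic; split => // s /=; rewrite in_itv/=.
apply: contra_notT; rewrite -leNgt => sa _.
by rewrite fc//; move: tca sa; lra.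
Qed.

Lemma le_normr_pr_convf p f t : measurable_fun setT f ->
  (`|pr_convf p f t|%:E <= \int[pr_set p]_s `|f (t - s)|%:E)%E.
Proof.
move=> mf; apply: (@le_trans _ _ `|\int[pr_set p]_s (f (t - s))%:E|%E).
  (* If the integral is infinite, [fine] returns 0 and the bound is trivial. *)
  by rewrite /pr_convf /Rintegral; case: (\int[_]_s _)%E => //=; rewrite normr0 leey.
apply: le_abse_integral => //.
by apply/measurable_EFinP; exact: measurable_comp_subl.
Qed.

(** This keeps the modified inputs in the L^q class. The power-mean inequality bounds |p * f|^q by a
    constant times p * |f|^q, which is locally integrable by [Lqloc_conv_lty]. *)
Lemma Lqloc_pr_convf p q f : 1 <= q -> Lqloc q f -> Lqloc q (pr_convf p f).
Proof.
move=> q1 Vf; have [mf [c fc] fq] := Vf.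
have q0 : 0 < q := lt_le_trans ltr01 q1.
have [a pa] := pr_left p.
split => [||b].
- exact: measurable_pr_convf.
- by exists (c + a) => t; exact: pr_convf_left.
(* For every t <= b, s in D is the only range that contributes: below a the measure vanishes, and
   above b - c one has t - s < c. The constant p(D)^(q-1) is thus uniform in t. *)
pose D : set R := `[a, b - c]%classic.
have mD : measurable D by exact: measurable_itv.
have mI (r : R) : 0 < r -> measurable_fun setT
    (fun t : R => \int[pr_set p]_s (`|f (t - s)| `^ r)%:E)%E.
  move=> r0; apply: (@measurable_conv_integral _ p (fun t => `|f t| `^ r)) => //.
  exact: measurable_normr_powR.
apply: (@le_lt_trans _ _ (\int[mu]_(t in `]-oo, b])
   (pr_set p D `^ (q - 1) * \int[pr_set p]_s (`|f (t - s)| `^ q)%:E))%E).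
  apply: ge0_le_integral => //.
  - apply: measurable_funTS; apply/measurable_EFinP.
    exact (measurable_normr_powR q (measurable_pr_convf p mf)).
  - by apply: measurable_funTS; apply: emeasurable_funM => //; exact: mI.
  move=> t; rewrite /= in_itv/= => tb.
  apply: le_trans
    (@le_poweR_integral _ _ _ _ q D (fun s => `|f (t - s)|) q1 mD _ _ _) => //.
  - rewrite -poweR_EFin; apply: gt0_ler_poweR; first exact: ltW.
    + by rewrite in_itv/= lee_fin normr_ge0 leey.
    + by rewrite in_itv/= leey integral_ge0.
    exact: le_normr_pr_convf.
  - by apply: measurableT_comp => //; exact (measurable_comp_subl t mf).
  - exists `]-oo, a[%classic; split => // s /=; rewrite in_itv/=.
    apply: contra_notT; rewrite -leNgt => sa; rewrite /D/= in_itv/= sa/= => /negP.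
    by rewrite -ltNge => bs; rewrite fc ?normr0//; move: tb bs; lra.
rewrite ge0_integralZl//.
- rewrite lte_mul_pinfty ?poweR_ge0//; last exact: Lqloc_conv_lty.
  by rewrite ge0_fin_numE ?poweR_ge0// poweR_lty//; exact: pr_locfin.
- by apply: measurable_funTS; exact: mI.
- by move=> t _; apply: integral_ge0 => s _; rewrite lee_fin powR_ge0.
- exact: poweR_ge0.
Qed.

End Lqloc.

(** * Positive measures as convolution operators, up to null sets *)

Section ConvolutionOperators.
Context {R : realType}.
Local Notation mu := (@lebesgue_measure R).
Implicit Types (p : pradon R) (f g : R -> R) (q : R).

(* Instance resolution fails on R, since the measurable structure which carries
   the Lebesgue measure is that of [measurableTypeR R]. *)
#[global] Instance ae_lebesgue_filter : Filter (almost_everywhere mu) :=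
  ae_filter_ringOfSetsType mu.

Definition aeq f g : Prop := {ae mu, forall t, f t = g t}.

Lemma aeq_refl f : aeq f f. Proof. exact: aeW. Qed.

Lemma aeq_sym f g : aeq f g -> aeq g f.
Proof. by apply: filterS => t ->. Qed.

Lemma aeq_trans g f h : aeq f g -> aeq g h -> aeq f h.
Proof. by apply: filterS2 => t -> ->. Qed.

Lemma ge0_integral_pr_conv p1 p2 (F : R -> \bar R) :
  measurable_fun setT F -> (forall x, 0 <= F x)%E ->
  (\int[pr_set (pr_conv p1 p2)]_z F z =
   \int[pr_set p1]_x \int[pr_set p2]_y F (x + y)%R)%E.
Proof.
move=> mF F0.
transitivity (\int[(pr_set p1 \x pr_set p2)%E]_z (F \o Defs.add_pair) z)%E.
  have := @ge0_integral_pushforward _ _ _ _ _ _ measurable_add_pair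
    (pr_set p1 \x pr_set p2)%E setT F measurableT mF.
  by rewrite preimage_setT; apply=> x _.
rewrite fubini_tonelli1//; last by move=> z; exact: F0.
exact (measurableT_comp mF measurable_add_pair).
Qed.

Lemma pr_conv_comm p1 p2 (A : set R) : measurable A ->
  pr_set (pr_conv p1 p2) A = pr_set (pr_conv p2 p1) A.
Proof.
move=> mA.
have E (p : pradon R) : pr_set p A = (\int[pr_set p]_x (\1_A x)%:E)%E.
  by rewrite integral_indic// setIT.
have mA1 : measurable_fun setT (fun x : R => (\1_A x)%:E : \bar R).
  by apply/measurable_EFinP; exact: measurable_indic.
rewrite !E !ge0_integral_pr_conv//.
rewrite (fubini_tonelli (fun z : R * R => (\1_A (z.1 + z.2))%:E)).
- by apply: eq_integral => x _; apply: eq_integral => y _; rewrite addrC.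
- exact (measurableT_comp mA1 measurable_add_pair).
- by move=> z; rewrite lee_fin.
Qed.

Lemma pr_convf_lin p (c : R) f g : Lqloc 1 f -> Lqloc 1 g ->
  aeq (pr_convf p (fun t => c * f t + g t))
      (fun t => c * pr_convf p f t + pr_convf p g t).
Proof.
move=> Vf Vg; have := ae_pr_integrable p Vg; have := ae_pr_integrable p Vf.
apply: filterS2 => t If Ig; rewrite /pr_convf RintegralD//; last first.
  exact (integrableZl measurableT c If).
by rewrite RintegralZl.
Qed.

Lemma pr_convf_add p1 p2 f : Lqloc 1 f ->
  aeq (pr_convf (pr_add p1 p2) f) (fun t => pr_convf p1 f t + pr_convf p2 f t).
Proof.
move=> Vf; have := ae_pr_integrable p1 Vf; have := ae_pr_integrable p2 Vf.
apply: filterS2 => t I2 I1; rewrite /pr_convf /Rintegral -fineD ?integrable_fin_num//.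
by rewrite -integral_measure_add.
Qed.

Lemma eq_pr_convf p1 p2 f : (forall A, measurable A -> pr_set p1 A = pr_set p2 A) ->
  pr_convf p1 f = pr_convf p2 f.
Proof.
move=> p12; apply/funext => t; rewrite /pr_convf /Rintegral.
by congr fine; apply: eq_measure_integral => A mA _; exact: p12.
Qed.

(** Fubini's theorem on the product measure, at those t where the convolution with [pr_conv p1 p2]
    converges absolutely. *)
Lemma pr_convf_conv p1 p2 f : Lqloc 1 f ->
  aeq (pr_convf (pr_conv p1 p2) f) (pr_convf p1 (pr_convf p2 f)).
Proof.
move=> Vf; have [mf _ _] := Vf.
have := ae_pr_integrable (pr_conv p1 p2) Vf; apply: filterS => t /= It.
pose F z := (f (t - z))%:E.
have mF : measurable_fun setT F.
  by apply/measurable_EFinP; exact (measurable_comp_subl t mf).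
have mG : measurable_fun setT (F \o Defs.add_pair).
  exact (measurableT_comp mF measurable_add_pair).
have IG : (pr_set p1 \x pr_set p2)%E.-integrable setT (F \o Defs.add_pair).
  apply/integrable12ltyP => //.
  have /integrableP[_] := It.
  by rewrite ge0_integral_pr_conv//; exact: measurableT_comp.
rewrite /pr_convf /Rintegral; congr fine.
transitivity (\int[(pr_set p1 \x pr_set p2)%E]_z (F \o Defs.add_pair) z)%E.
  have := @integral_pushforward _ _ _ _ _ _ measurable_add_pair
    (pr_set p1 \x pr_set p2)%E setT F mF.
  by rewrite preimage_setT; apply.
rewrite -integral12_prod_meas1//; apply: ae_eq_integral => //.
- exact: (measurable_fubini_F IG).
- apply/measurable_EFinP; exact (measurable_comp_subl t (measurable_pr_convf p2 mf)).
(* [pr_convf] takes the [fine] part of the inner integral, which loses nothing for almost every s,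
   where that integral is finite. *)
- have := ae_integrable1 IG; apply: filterS => s /= Is _.
  rewrite /fubini_F /= -[LHS]fineK; last exact: integrable_fin_num.
  congr (fine _)%:E; apply: eq_integral => r _.
  by rewrite /F /Defs.add_pair/= opprD addrA.
Qed.

(** A Lebesgue-null set may be charged by p, so equality can fail at some t. By Tonelli's theorem
    and translation invariance, the double integral of |f - g|(t - s) is zero, so for almost every t
    the two integrands agree p-almost everywhere. *)
Lemma pr_convf_aeq p f g : measurable_fun setT f -> measurable_fun setT g ->
  aeq f g -> aeq (pr_convf p f) (pr_convf p g).
Proof.
move=> mf mg fg.
pose h t := `|f t - g t|.
have mh : measurable_fun setT h.
  by apply: measurableT_comp => //; exact: measurable_funB.
have h0 t : 0 <= h t by exact: normr_ge0.
pose H z := (h (z.1 - z.2))%:E.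
have mH : measurable_fun setT H.
  by apply/measurable_EFinP; exact (measurable_comp_sub mh).
have H0 (z : R * R) : (0 <= H z)%E by rewrite lee_fin.
have mI : measurable_fun setT (fun t : R => \int[pr_set p]_s (h (t - s))%:E)%E.
  exact: measurable_conv_integral.
have I0 : (\int[mu]_t \int[pr_set p]_s (h (t - s))%:E = 0)%E.
  transitivity (\int[pr_set p]_s \int[mu]_t (h (t - s))%:E)%E.
    exact (@fubini_tonelli _ _ (measurableTypeR R) _ R mu (pr_set p) H mH H0).
  apply: integral0_eq => s _.
  rewrite (@ge0_integral_subr _ s (fun t => (h t)%:E)).
  - rewrite (ae_eq_integral (cst 0%E)) ?integral0//.
    + exact/measurable_EFinP.
    + by apply: filterS fg => t fgt _; rewrite /h fgt subrr normr0.
  - exact/measurable_EFinP.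
  - by move=> t; rewrite lee_fin.
have : (\int[mu]_t `|\int[pr_set p]_s (h (t - s))%:E| = 0)%E.
  rewrite -[RHS]I0; apply: eq_integral => t _.
  by rewrite gee0_abs//; apply: integral_ge0 => s _; rewrite lee_fin.
move/(ae_eq_integral_abs mu measurableT mI).1; apply: filterS => t /(_ I) It.
have : (\int[pr_set p]_s `|(f (t - s) - g (t - s))%:E| = 0)%E by exact: It.
have mt (k : R -> R) : measurable_fun setT k ->
    measurable_fun setT (fun s : R => (k (t - s))%:E).
  by move=> mk; apply/measurable_EFinP; exact (measurable_comp_subl t mk).
move/(ae_eq_integral_abs (pr_set p) measurableT
  (mt (fun t => f t - g t) (measurable_funB mf mg))).1 => fgt.
rewrite /pr_convf /Rintegral; congr fine; apply: ae_eq_integral => //.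
- exact: (mt _ mf).
- exact: (mt _ mg).
- apply: filterS fgt => s /[apply] -[] /eqP.
  by rewrite subr_eq0 => /eqP ->.
Qed.

End ConvolutionOperators.

(** * Signed measures as convolution operators *)

Section MradonOperators.
Context {R : realType}.
Local Notation mu := (@lebesgue_measure R).
Implicit Types (p : pradon R) (a b : mradon R) (f g : R -> R) (q : R).

Lemma Lqloc_add q f g : 1 <= q -> Lqloc q f -> Lqloc q g -> Lqloc q (f + g).
Proof.
move=> q1 [mf [c fc] fq] [mg [c' gc] gq].
have q0 : 0 < q := lt_le_trans ltr01 q1.
split => [||b].
- exact: measurable_funD.
- exists (Num.min c c') => t; rewrite lt_min => /andP[tc tc'].
  by rewrite fctE fc// gc// addr0.
have m2 (k : R -> R) : measurable_fun setT k -> measurable_fun `]-oo, b]%classic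
    (fun t => (2 `^ q * `|k t| `^ q)%:E).
  move=> mk; apply: measurable_funTS; apply/measurable_EFinP/measurable_funM => //.
  exact (measurable_normr_powR q mk).
apply: (@le_lt_trans _ _ (\int[mu]_(t in `]-oo, b])
    ((2 `^ q * `|f t| `^ q)%:E + (2 `^ q * `|g t| `^ q)%:E))%E).
  apply: ge0_le_integral => //=.
  - apply: measurable_funTS; apply/measurable_EFinP.
    exact (measurable_normr_powR q (measurable_funD mf mg)).
  - by apply: emeasurable_funD; exact: m2.
  move=> t _; rewrite -EFinD lee_fin -!powRM//.
  (* The q-th power of the maximum is one of the two q-th powers, hence at most their sum. *)
  have fg : `|(f + g) t| <= 2 * Num.max `|f t| `|g t|.
    rewrite mulr_natl mulr2n (le_trans (ler_normD _ _))// lerD//.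
      by rewrite le_max lexx.
    by rewrite le_max lexx orbT.
  have M0 : 0 <= Num.max `|f t| `|g t| by rewrite le_max normr_ge0.
  apply: (@le_trans _ _ ((2 * Num.max `|f t| `|g t|) `^ q)).
    by apply: ge0_ler_powR; rewrite ?nnegrE ?mulr_ge0// ltW.
  by have [_|_] := leP `|f t| `|g t|; rewrite ?lerDr ?lerDl powR_ge0.
have i2 (k : R -> R) : measurable_fun setT k ->
    (\int[mu]_(t in `]-oo, b]) (`|k t| `^ q)%:E < +oo)%E ->
    (\int[mu]_(t in `]-oo, b]) (2 `^ q * `|k t| `^ q)%:E < +oo)%E.
  move=> mk kq; under eq_integral do rewrite EFinM.
  rewrite ge0_integralZl//.
  - by rewrite lte_mul_pinfty ?lee_fin ?powR_ge0.
  - apply: measurable_funTS; apply/measurable_EFinP.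
    exact (measurable_normr_powR q mk).
rewrite ge0_integralD//=; [|exact: m2|exact: m2].
by rewrite lte_add_pinfty//; exact: i2.
Qed.

Lemma Lqloc_opp q f : Lqloc q f -> Lqloc q (- f).
Proof.
move=> [mf [c fc] fq]; split => [||b].
- exact: measurable_funN.
- by exists c => t /fc; rewrite fctE => ->; rewrite oppr0.
by under eq_integral do rewrite fctE normrN.
Qed.

Lemma Lqloc0 q : 0 < q -> Lqloc q (0 : R -> R).
Proof.
move=> q0; split => [||b]; first exact: measurable_cst.
  by exists 0.
rewrite integral0_eq // => t _; have -> : (0 : R -> R) t = 0 by [].
by rewrite normr0 powR0 ?gt_eqF.
Qed.

Lemma Lqloc_sum q (I : Type) (r : seq I) (F : I -> R -> R) : 1 <= q ->
  (forall i, Lqloc q (F i)) -> Lqloc q (\sum_(i <- r) F i).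
Proof.
move=> q1 VF; apply: (big_ind (Lqloc q)) => [|f g|i _]; last exact: VF.
  by apply: Lqloc0; exact: lt_le_trans q1.
exact: Lqloc_add.
Qed.

Lemma Lqloc_mr_convf a q f : 1 <= q -> Lqloc q f -> Lqloc q (mr_convf a f).
Proof.
move=> q1 Vf; have V p := Lqloc_pr_convf p q1 Vf.
exact: Lqloc_add q1 (V _) (Lqloc_opp (V _)).
Qed.

Lemma aeqD f f' g g' : aeq f f' -> aeq g g' -> aeq (f + g) (f' + g').
Proof. by apply: filterS2 => t; rewrite !fctE => -> ->. Qed.

Lemma aeqN f f' : aeq f f' -> aeq (- f) (- f').
Proof. by apply: filterS => t; rewrite !fctE => ->. Qed.

Lemma aeq_sum (I : Type) (r : seq I) (F G : I -> R -> R) :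
  (forall i, aeq (F i) (G i)) -> aeq (\sum_(i <- r) F i) (\sum_(i <- r) G i).
Proof.
move=> FG; elim/big_ind2: _ => //; first exact: aeq_refl.
by move=> *; exact: aeqD.
Qed.

Lemma mr_convfE a f : mr_convf a f = pr_convf (mr_pos a) f - pr_convf (mr_neg a) f.
Proof. by []. Qed.

Lemma pr_convfD p f g : Lqloc 1 f -> Lqloc 1 g ->
  aeq (pr_convf p (f + g)) (pr_convf p f + pr_convf p g).
Proof.
move=> Vf Vg; have := pr_convf_lin p 1 Vf Vg.
have -> : (fun t => 1 * f t + g t) = f + g by apply/funext => t; rewrite mul1r.
by apply: filterS => t ->; rewrite mul1r.
Qed.

Lemma pr_convf0 p : pr_convf p 0 = 0.
Proof. by apply/funext => t; rewrite /pr_convf /Rintegral integral0. Qed.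

Lemma pr_convfN p f : Lqloc 1 f -> aeq (pr_convf p (- f)) (- pr_convf p f).
Proof.
move=> Vf; have := pr_convf_lin p (- 1) Vf (Lqloc0 ltr01).
have -> : (fun t => - 1 * f t + (0 : R -> R) t) = - f.
  by apply/funext => t; rewrite mulN1r addr0.
by apply: filterS => t ->; rewrite pr_convf0 mulN1r addr0.
Qed.

Lemma pr_convfB p f g : Lqloc 1 f -> Lqloc 1 g ->
  aeq (pr_convf p (f - g)) (pr_convf p f - pr_convf p g).
Proof.
move=> Vf Vg; have := pr_convfD p Vf (Lqloc_opp Vg); have := pr_convfN p Vg.
by apply: filterS2 => t; rewrite !fctE => -> ->.
Qed.

Lemma mr_convfD a f g : Lqloc 1 f -> Lqloc 1 g ->
  aeq (mr_convf a (f + g)) (mr_convf a f + mr_convf a g).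
Proof.
move=> Vf Vg; have := pr_convfD (mr_pos a) Vf Vg; have := pr_convfD (mr_neg a) Vf Vg.
apply: filterS2 => t; rewrite mr_convfE !fctE !mr_convfE !fctE => -> ->; ring.
Qed.

Lemma mr_convfB a f g : Lqloc 1 f -> Lqloc 1 g ->
  aeq (mr_convf a (f - g)) (mr_convf a f - mr_convf a g).
Proof.
move=> Vf Vg; have := pr_convfB (mr_pos a) Vf Vg; have := pr_convfB (mr_neg a) Vf Vg.
apply: filterS2 => t; rewrite mr_convfE !fctE !mr_convfE !fctE => -> ->; ring.
Qed.

Lemma mr_convf0 a : mr_convf a 0 = 0.
Proof. by rewrite mr_convfE !pr_convf0 subrr. Qed.

Lemma mr_convf_aeq a f g : Lqloc 1 f -> Lqloc 1 g ->
  aeq f g -> aeq (mr_convf a f) (mr_convf a g).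
Proof.
move=> [mf _ _] [mg _ _] fg.
have := pr_convf_aeq (mr_pos a) mf mg fg; have := pr_convf_aeq (mr_neg a) mf mg fg.
by apply: filterS2 => t; rewrite !mr_convfE !fctE => -> ->.
Qed.

Lemma mr_convf_sum a (I : Type) (r : seq I) (F : I -> R -> R) :
  (forall i, Lqloc 1 (F i)) ->
  aeq (mr_convf a (\sum_(i <- r) F i)) (\sum_(i <- r) mr_convf a (F i)).
Proof.
move=> VF; elim: r => [|i r IH]; first by rewrite !big_nil mr_convf0; exact: aeq_refl.
rewrite !big_cons; apply: aeq_trans (mr_convfD a (VF i) _) _; first exact: Lqloc_sum.
by apply: aeqD => //; exact: aeq_refl.
Qed.

(** [mradon_eq] equates sums of positive measures; acting with these sums and separating the terms
    where they converge gives the equality of differences. *)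
Lemma mr_convf_eq a b f : Lqloc 1 f -> mradon_eq a b ->
  aeq (mr_convf a f) (mr_convf b f).
Proof.
move=> Vf ab.
have E : pr_convf (pr_add (mr_pos a) (mr_neg b)) f =
         pr_convf (pr_add (mr_pos b) (mr_neg a)) f.
  by apply: eq_pr_convf => A mA; rewrite !pr_addE; exact: ab.
have := pr_convf_add (mr_pos b) (mr_neg a) Vf.
have := pr_convf_add (mr_pos a) (mr_neg b) Vf.
apply: filterS2 => t; rewrite E => -> H; rewrite !mr_convfE !fctE.
by apply/eqP; rewrite subr_eq addrAC eq_sym subr_eq H.
Qed.

Lemma mr_convf_add a b f : Lqloc 1 f ->
  aeq (mr_convf (mr_add a b) f) (mr_convf a f + mr_convf b f).
Proof.
move=> Vf; have := pr_convf_add (mr_pos a) (mr_pos b) Vf.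
have := pr_convf_add (mr_neg a) (mr_neg b) Vf.
apply: filterS2 => t; rewrite !(mr_convfE, fctE)/= => -> ->; ring.
Qed.

Lemma mr_convf_opp a f : mr_convf (mr_opp a) f = - mr_convf a f.
Proof. by apply/funext => t; rewrite !fctE /mr_convf/= opprB. Qed.

Lemma mr_convf_zero f : mr_convf mr_zero f = 0.
Proof. by rewrite mr_convfE subrr. Qed.

Lemma mr_convf_dirac s f : measurable_fun setT f ->
  mr_convf (mr_dirac s) f = fun t => f (t - s).
Proof.
move=> mf; apply/funext => t; rewrite mr_convfE !fctE /pr_convf /Rintegral.
rewrite integral_measure_zero /= subr0 integral_dirac//; last first.
  by apply/measurable_EFinP; exact (measurable_comp_subl t mf).
by rewrite diracT mul1e.
Qed.

Lemma mr_convf_conv a b f : Lqloc 1 f ->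
  aeq (mr_convf (mr_conv a b) f) (mr_convf a (mr_convf b f)).
Proof.
move=> Vf.
have VC p : Lqloc 1 (pr_convf p f) by exact: Lqloc_pr_convf.
have H p := pr_convfB p (VC (mr_pos b)) (VC (mr_neg b)).
have K p p' := pr_convf_add p p' Vf.
have L p p' := pr_convf_conv p p' Vf.
have := H (mr_pos a); have := H (mr_neg a).
have := K (pr_conv (mr_pos a) (mr_pos b)) (pr_conv (mr_neg a) (mr_neg b)).
have := K (pr_conv (mr_pos a) (mr_neg b)) (pr_conv (mr_neg a) (mr_pos b)).
have := L (mr_pos a) (mr_pos b); have := L (mr_neg a) (mr_neg b).
have := L (mr_pos a) (mr_neg b); have := L (mr_neg a) (mr_pos b).
move=> e1 e2 e3 e4 e5 e6 e7 e8; near=> t.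
rewrite !mr_convfE !fctE /=.
rewrite (near e5 t) ?(near e6 t) ?(near e7 t) ?(near e8 t); [|by []..].
rewrite !fctE (near e1 t) ?(near e2 t) ?(near e3 t) ?(near e4 t); [ring|by []..].
Unshelve. all: by end_near. Qed.

Lemma mr_conv_comm a b : mradon_eq (mr_conv a b) (mr_conv b a).
Proof.
move=> A mA; rewrite /mr_conv !pr_addE.
rewrite !(@pr_conv_comm _ (mr_pos b))// !(@pr_conv_comm _ (mr_neg b))//.
by congr (_ + _)%E; rewrite addeC.
Qed.

Lemma mradon_eq_scale1 a : mradon_eq (mr_scale 1 a) a.
Proof.
move=> A mA; rewrite /mr_scale ler01 /= !pr_scaleE /= normr1 !mul1e.
by [].
Qed.

Lemma mradon_eq_scale0 a : mradon_eq (mr_scale 0 a) mr_zero.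
Proof.
by move=> A mA; rewrite /mr_scale lexx /= !pr_scaleE /= normr0 !mul0e.
Qed.

End MradonOperators.

Local Open Scope quotient_scope.

(** * The commutative ring of convolution operators *)

Section MradonRing.
Context {R : realType}.
Implicit Types (a b : mradon R) (f g : R -> R).

HB.instance Definition _ := gen_eqMixin (mradon R).
HB.instance Definition _ := gen_choiceMixin (mradon R).

Definition mr_equiv a b : bool :=
  `[< forall f, Lqloc 1 f -> aeq (mr_convf a f) (mr_convf b f) >].

Let mr_equiv_refl : reflexive mr_equiv.
Proof. by move=> a; apply/asboolP => f _; exact: aeq_refl. Qed.

Let mr_equiv_sym : symmetric mr_equiv.
Proof.
by move=> a b; apply/idP/idP => /asboolP h; apply/asboolP => f Vf;
  exact/aeq_sym/h.
Qed.

Let mr_equiv_trans : transitive mr_equiv.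
Proof.
move=> b a c /asboolP h1 /asboolP h2; apply/asboolP => f Vf.
exact: aeq_trans (h1 f Vf) (h2 f Vf).
Qed.

Canonical mr_equiv_canonical :=
  EquivRel mr_equiv mr_equiv_refl mr_equiv_sym mr_equiv_trans.

(* The convolution algebra of Radon measures, as an algebra of operators: two
   measures are identified when they act in the same way on the L^1_loc
   functions with support bounded on the left. *)
Definition mring : Type := {eq_quot mr_equiv}.
HB.instance Definition _ := Choice.on mring.
HB.instance Definition _ := EqQuotient.on mring.

Implicit Types x y z : mring.

Definition act x : (R -> R) -> R -> R := mr_convf (repr x).

Lemma act_pi a f : Lqloc 1 f -> aeq (act (\pi_mring a) f) (mr_convf a f).
Proof.
move=> Vf; rewrite /act; have /eqmodP/asboolP := reprK (\pi_mring a).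
exact.
Qed.

(** Turns almost everywhere identities of operators into Leibniz equalities, which the ring
    structure demands. *)
Lemma act_ext x y : (forall f, Lqloc 1 f -> aeq (act x f) (act y f)) -> x = y.
Proof.
by move=> h; rewrite -(reprK x) -(reprK y); apply/eqmodP/asboolP => f /h.
Qed.

Lemma Lqloc_act x q f : 1 <= q -> Lqloc q f -> Lqloc q (act x f).
Proof. exact: Lqloc_mr_convf. Qed.

Lemma Lqloc1_act x f : Lqloc 1 f -> Lqloc 1 (act x f).
Proof. exact: Lqloc_act. Qed.

Lemma act_aeq x f g : Lqloc 1 f -> Lqloc 1 g -> aeq f g -> aeq (act x f) (act x g).
Proof. exact: mr_convf_aeq. Qed.

Definition mring_zero : mring := \pi_mring mr_zero.
Definition mring_one : mring := \pi_mring (mr_dirac 0).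
Definition mring_opp x : mring := \pi_mring (mr_opp (repr x)).
Definition mring_add x y : mring := \pi_mring (mr_add (repr x) (repr y)).
Definition mring_mul x y : mring := \pi_mring (mr_conv (repr x) (repr y)).

Lemma act_zero f : Lqloc 1 f -> aeq (act mring_zero f) 0.
Proof. by move=> Vf; have := act_pi mr_zero Vf; rewrite mr_convf_zero. Qed.

Lemma act_one f : Lqloc 1 f -> aeq (act mring_one f) f.
Proof.
move=> Vf; have [mf _ _] := Vf; have := act_pi (mr_dirac 0) Vf.
by rewrite mr_convf_dirac//; under [X in aeq _ X]eq_fun do rewrite subr0.
Qed.

Lemma act_oppE x f : Lqloc 1 f -> aeq (act (mring_opp x) f) (- act x f).
Proof. by move=> Vf; have := act_pi (mr_opp (repr x)) Vf; rewrite mr_convf_opp. Qed.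

Lemma act_addE x y f : Lqloc 1 f -> aeq (act (mring_add x y) f) (act x f + act y f).
Proof. by move=> Vf; apply: aeq_trans (act_pi _ Vf) _; exact: mr_convf_add. Qed.

Lemma act_mulE x y f : Lqloc 1 f -> aeq (act (mring_mul x y) f) (act x (act y f)).
Proof. by move=> Vf; apply: aeq_trans (act_pi _ Vf) _; exact: mr_convf_conv. Qed.

Let addA : associative mring_add.
Proof.
move=> x y z; apply: act_ext => f Vf.
apply: aeq_trans (act_addE _ _ Vf) _; apply/aeq_sym.
apply: aeq_trans (act_addE _ _ Vf) _.
apply: aeq_trans (aeqD (act_addE _ _ Vf) (aeq_refl _)) _.
rewrite -addrA; apply: aeqD; first exact: aeq_refl.
exact/aeq_sym/act_addE.
Qed.

Let addC : commutative mring_add.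
Proof.
move=> x y; apply: act_ext => f Vf.
apply: aeq_trans (act_addE _ _ Vf) _; rewrite addrC; exact/aeq_sym/act_addE.
Qed.

Let add0 : left_id mring_zero mring_add.
Proof.
move=> x; apply: act_ext => f Vf.
apply: aeq_trans (act_addE _ _ Vf) _.
by apply: aeq_trans (aeqD (act_zero Vf) (aeq_refl _)) _; rewrite add0r; exact: aeq_refl.
Qed.

Let addN : left_inverse mring_zero mring_opp mring_add.
Proof.
move=> x; apply: act_ext => f Vf.
apply: aeq_trans (act_addE _ _ Vf) _.
apply: aeq_trans (aeqD (act_oppE _ Vf) (aeq_refl _)) _.
by rewrite addNr; exact/aeq_sym/act_zero.
Qed.

HB.instance Definition _ := GRing.isZmodule.Build mring addA addC add0 addN.

Let mulA : associative mring_mul.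
Proof.
move=> x y z; apply: act_ext => f Vf.
apply: aeq_trans (act_mulE _ _ Vf) _; apply/aeq_sym.
apply: aeq_trans (act_mulE _ _ Vf) _.
apply: aeq_trans (act_mulE _ _ (Lqloc1_act _ Vf)) _.
apply/aeq_sym/act_aeq; last exact: act_mulE.
- exact: Lqloc1_act.
- by do 2 apply: Lqloc1_act.
Qed.

Let mulC : commutative mring_mul.
Proof.
(* Composition of operators says nothing about commutativity, so this law goes back to the symmetry
   of the product measure. *)
move=> x y; apply: act_ext => f Vf; rewrite /mring_mul.
apply: aeq_trans (act_pi _ Vf) _; apply/aeq_sym; apply: aeq_trans (act_pi _ Vf) _.
exact/mr_convf_eq/mr_conv_comm.
Qed.

Let mul1 : left_id mring_one mring_mul.
Proof.
move=> x; apply: act_ext => f Vf; apply: aeq_trans (act_mulE _ _ Vf) _.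
exact/act_one/Lqloc1_act.
Qed.

Let mulD : left_distributive mring_mul mring_add.
Proof.
move=> x y z; apply: act_ext => f Vf; apply: aeq_trans (act_mulE _ _ Vf) _.
apply: aeq_trans (act_addE _ _ (Lqloc1_act _ Vf)) _; apply/aeq_sym.
by apply: aeq_trans (act_addE _ _ Vf) _; apply: aeqD; exact: act_mulE.
Qed.

HB.instance Definition _ :=
  GRing.Zmodule_isComPzRing.Build mring mulA mulC mul1 mulD.

Lemma act0 f : Lqloc 1 f -> aeq (act 0 f) 0.
Proof. exact: act_zero. Qed.

Lemma act1 f : Lqloc 1 f -> aeq (act 1 f) f.
Proof. exact: act_one. Qed.

Lemma actN x f : Lqloc 1 f -> aeq (act (- x) f) (- act x f).
Proof. exact: act_oppE. Qed.

Lemma actD x y f : Lqloc 1 f -> aeq (act (x + y) f) (act x f + act y f).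
Proof. exact: act_addE. Qed.

Lemma actM x y f : Lqloc 1 f -> aeq (act (x * y) f) (act x (act y f)).
Proof. exact: act_mulE. Qed.

Lemma act_sum_l (I : Type) (r : seq I) (X : I -> mring) f : Lqloc 1 f ->
  aeq (act (\sum_(i <- r) X i) f) (\sum_(i <- r) act (X i) f).
Proof.
move=> Vf; elim: r => [|i r IH]; first by rewrite !big_nil; exact: act0.
rewrite !big_cons; apply: aeq_trans (actD _ _ Vf) _.
by apply: aeqD => //; exact: aeq_refl.
Qed.

Lemma pi_mr_eq a b : mradon_eq a b -> \pi_mring a = \pi_mring b.
Proof. by move=> ab; apply/eqmodP/asboolP => f Vf; exact: mr_convf_eq. Qed.

Lemma pi_mr_zero : \pi_mring mr_zero = 0.
Proof. by []. Qed.

Lemma pi_mr_dirac0 : \pi_mring (mr_dirac 0) = 1.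
Proof. by []. Qed.

Lemma pi_mr_add a b : \pi_mring (mr_add a b) = \pi_mring a + \pi_mring b.
Proof.
apply: act_ext => f Vf; apply: aeq_trans (act_pi _ Vf) _.
apply: aeq_trans (mr_convf_add _ _ Vf) _; apply/aeq_sym.
by apply: aeq_trans (actD _ _ Vf) _; apply: aeqD; exact: act_pi.
Qed.

Lemma pi_mr_opp a : \pi_mring (mr_opp a) = - \pi_mring a.
Proof.
apply: act_ext => f Vf; apply: aeq_trans (act_pi _ Vf) _.
rewrite mr_convf_opp; apply/aeq_sym.
by apply: aeq_trans (actN _ Vf) _; apply: aeqN; exact: act_pi.
Qed.

Lemma pi_mr_conv a b : \pi_mring (mr_conv a b) = \pi_mring a * \pi_mring b.
Proof.
apply: act_ext => f Vf; apply: aeq_trans (act_pi _ Vf) _.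
apply: aeq_trans (mr_convf_conv _ _ Vf) _; apply/aeq_sym.
apply: aeq_trans (actM _ _ Vf) _.
apply: aeq_trans (act_pi _ (Lqloc1_act _ Vf)) _.
by apply: mr_convf_aeq; [exact: Lqloc1_act|exact: Lqloc_mr_convf|exact: act_pi].
Qed.

Lemma pi_mr_sum n (F : 'I_n -> mradon R) :
  \pi_mring (mr_sum F) = \sum_k \pi_mring (F k).
Proof.
rewrite /mr_sum; elim/big_rec2: _ => // i x y _ <-.
by rewrite pi_mr_add.
Qed.

Definition mx_pi n p (M : 'M[mradon R]_(n, p)) : 'M[mring]_(n, p) :=
  \matrix_(i, j) \pi_mring (M i j).

Lemma mx_pi_conv n p r (M : 'M[mradon R]_(n, p)) (M' : 'M[mradon R]_(p, r)) :
  mx_pi (mx_conv M M') = mx_pi M *m mx_pi M'.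
Proof.
apply/matrixP => i j; rewrite !mxE pi_mr_sum.
by apply: eq_bigr => k _; rewrite pi_mr_conv !mxE.
Qed.

Lemma mx_pi_eq n p (M M' : 'M[mradon R]_(n, p)) : mx_eq M M' -> mx_pi M = mx_pi M'.
Proof. by move=> MM; apply/matrixP => i j; rewrite !mxE; exact: pi_mr_eq. Qed.

Lemma mx_pi_scale1 n : mx_pi (mx_scale (1%:M : 'M[R]_n) (mr_dirac 0)) = 1%:M.
Proof.
apply/matrixP => i j; rewrite !mxE; case: (i == j) => /=.
  by rewrite (pi_mr_eq (mradon_eq_scale1 _)) pi_mr_dirac0.
by rewrite (pi_mr_eq (mradon_eq_scale0 _)) pi_mr_zero.
Qed.

End MradonRing.
Arguments mring R : clear implicits.

(** * Supports expressed through the action on functions *)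

Section Causality.
Context {R : realType}.
Local Notation mu := (@lebesgue_measure R).
Implicit Types (f g : R -> R) (x y : mring R) (D : set R).

Definition aeq_on D f g : Prop := {ae mu, forall t, D t -> f t = g t}.

Lemma aeq_onW D f g : aeq f g -> aeq_on D f g.
Proof. by apply: filterS => t ->. Qed.

Lemma aeq_on_trans D g f h : aeq_on D f g -> aeq_on D g h -> aeq_on D f h.
Proof. by apply: filterS2 => t fg gh Dt; rewrite fg// gh. Qed.

Lemma aeq_aeq_on D g f h : aeq f g -> aeq_on D g h -> aeq_on D f h.
Proof. by apply: filterS2 => t fg gh Dt; rewrite fg gh. Qed.

Lemma aeq_onS D D' f g : D' `<=` D -> aeq_on D f g -> aeq_on D' f g.
Proof. by move=> DD; apply: filterS => t + /DD; apply. Qed.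

Lemma aeq_onD D f f' g g' : aeq_on D f f' -> aeq_on D g g' ->
  aeq_on D (f + g) (f' + g').
Proof. by apply: filterS2 => t ff gg Dt; rewrite !fctE ff// gg. Qed.

Lemma aeq_on_sum D (I : Type) (r : seq I) (F G : I -> R -> R) :
  (forall i, aeq_on D (F i) (G i)) -> aeq_on D (\sum_(i <- r) F i) (\sum_(i <- r) G i).
Proof.
move=> FG; elim/big_ind2: _ => //; first exact/aeq_onW/aeq_refl.
by move=> *; exact: aeq_onD.
Qed.

Lemma Lqloc_patch q D f : 0 < q -> measurable D -> Lqloc q f -> Lqloc q (f \_ D).
Proof.
move=> q0 mD [mf [c fc] fq]; split => [||b].
- by apply/(measurable_restrictT _ _).1 => //; exact: measurable_funTS.
- by exists c => t tc; rewrite patchE; case: ifP => // _; exact: fc.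
apply: le_lt_trans (fq b); apply: ge0_le_integral => //=.
- apply: measurable_funTS; apply/measurable_EFinP; apply: measurable_normr_powR.
  by apply/(measurable_restrictT _ _).1 => //; exact: measurable_funTS.
- apply: measurable_funTS; apply/measurable_EFinP.
  exact (measurable_normr_powR q mf).
- move=> t _; rewrite lee_fin patchE; case: ifP => // _.
  by rewrite normr0 powR0 ?gt_eqF// powR_ge0.
Qed.

(* For D = D' = R_+, this is the support condition of M(R_-). *)
Definition sends D D' x : Prop :=
  forall f, Lqloc 1 f -> aeq_on D f 0 -> aeq_on D' (act x f) 0.

(** Replacing f by its restriction to the complement of D changes it on a null set only, so
    vanishing almost everywhere on D may be taken to hold at every point of D. *)
Lemma sends_pi D D' (a : mradon R) : measurable D ->
  (forall f, Lqloc 1 f -> (forall t, D t -> f t = 0) ->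
    forall t, D' t -> mr_convf a f t = 0) ->
  sends D D' (\pi_(mring R) a)%qT.
Proof.
move=> mD h f Vf fD.
have Vf' : Lqloc 1 (f \_ (~` D)) by apply: Lqloc_patch => //; exact: measurableC.
apply: (aeq_on_trans (g := mr_convf a (f \_ (~` D)))).
  apply: aeq_onW; apply: aeq_trans (act_pi _ Vf) _; apply: mr_convf_aeq => //.
  apply: filterS fD => t ft; rewrite patchE in_setC; case: ifPn => // /negPn.
  by rewrite inE => /ft.
apply: aeW => t D't; apply: h => // s Ds.
by rewrite patchE in_setC mem_set.
Qed.

Lemma sendsS D D' D'' x : D'' `<=` D' -> sends D D' x -> sends D D'' x.
Proof. by move=> DD h f Vf /(h f Vf); exact: aeq_onS. Qed.

Lemma sends0 D D' : sends D D' 0.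
Proof. by move=> f Vf _; apply: aeq_onW; exact: act0. Qed.

Lemma sends1 D : sends D D 1.
Proof. by move=> f Vf; apply: aeq_aeq_on; exact: act1. Qed.

Lemma sendsD D D' x y : sends D D' x -> sends D D' y -> sends D D' (x + y).
Proof.
move=> hx hy f Vf fD; apply: aeq_aeq_on (actD _ _ Vf) _.
rewrite -[X in aeq_on _ _ X]addr0; apply: aeq_onD; [exact: hx|exact: hy].
Qed.

Lemma sendsN D D' x : sends D D' x -> sends D D' (- x).
Proof.
move=> hx f Vf fD; apply: aeq_aeq_on (actN _ Vf) _.
by apply: filterS (hx f Vf fD) => t xt Dt; rewrite !fctE xt// oppr0.
Qed.

Lemma sendsM D D' D'' x y : sends D' D'' x -> sends D D' y -> sends D D'' (x * y).
Proof.
move=> hx hy f Vf fD; apply: aeq_aeq_on (actM _ _ Vf) _.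
by apply: hx; [exact: Lqloc1_act|exact: hy].
Qed.

Lemma sends_sum D D' (I : Type) (r : seq I) (X : I -> mring R) :
  (forall i, sends D D' (X i)) -> sends D D' (\sum_(i <- r) X i).
Proof.
by move=> h; elim/big_ind: _ => //; [exact: sends0|exact: sendsD].
Qed.

Lemma sends_sign D D' n x : sends D D' x -> sends D D' ((-1) ^+ n * x).
Proof.
move=> hx; elim: n => [|n IH]; first by rewrite expr0 mul1r.
by rewrite exprS mulN1r mulNr; exact: sendsN.
Qed.

Lemma sends_det D n (M : 'M[mring R]_n) : (forall i j, sends D D (M i j)) ->
  sends D D (\det M).
Proof.
move=> hM; apply: sends_sum => s; apply: sends_sign.
by elim/big_ind: _ => //; [exact: sends1|move=> u v hu hv; exact: sendsM hu hv].
Qed.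

Lemma sends_adj D n (M : 'M[mring R]_n) : (forall i j, sends D D (M i j)) ->
  forall i j, sends D D ((\adj M) i j).
Proof.
move=> hM i j; rewrite mxE; apply: sends_sign; apply: sends_det => k l.
by rewrite !mxE.
Qed.

(* Operator form of: the support of x is contained in [-k, +oo[. *)
Definition lead (k : R) x : Prop :=
  forall c, sends `]-oo, c[%classic `]-oo, c - k[%classic x.

Lemma le_lead k k' x : k <= k' -> lead k x -> lead k' x.
Proof.
move=> kk h c; apply: sendsS (h c) => t; rewrite /= !in_itv/= => /lt_le_trans; apply.
by rewrite lerD2l lerN2.
Qed.

Lemma leadM k k' x y : lead k x -> lead k' y -> lead (k + k') (x * y).
Proof.
move=> hx hy c; apply: sendsM (hy c).
by have := hx (c - k'); rewrite -addrA -opprD (addrC k').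
Qed.

Lemma lead_det k n (M : 'M[mring R]_n) : (forall i j, lead k (M i j)) ->
  lead (n%:R * k) (\det M).
Proof.
move=> hM c; apply: sends_sum => s; apply: sends_sign.
(* Generalized to any list of rows for the induction; the full list has n elements, whence the
   factor n. *)
have H (r : seq 'I_n) (h : 'I_n -> 'I_n) :
    lead ((size r)%:R * k) (\prod_(i <- r) M i (h i)).
  elim: r => [|i r IH].
    by rewrite big_nil mul0r => c'; rewrite subr0; exact: sends1.
  by rewrite big_cons/= -natr1 mulrDl mul1r addrC; exact: leadM.
have := H (index_enum 'I_n).
by rewrite {1}/index_enum -enumT size_enum_ord => /(_ _ c); apply.
Qed.

Lemma lead_pi k (a : mradon R) : pr_set (mr_pos a) `]-oo, - k[%classic = 0%E ->
  pr_set (mr_neg a) `]-oo, - k[%classic = 0%E -> lead k (\pi_(mring R) a)%qT.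
Proof.
move=> ap an c; apply: sends_pi => // f [mf _ _] fc t; rewrite /= in_itv/= => tck.
by rewrite mr_convfE !fctE !(@pr_convf_left _ _ _ (- k) c)// ?subrr// => s sc;
  apply: fc; rewrite /= in_itv.
Qed.

(** For t >= 0 and s in [l, 0], t - s is in R_+, where f vanishes. Off [l, 0] the positive and
    negative parts coincide as measures, so their integrals cancel. *)
Lemma sends_MRminus (a : mradon R) : in_MRminus a ->
  sends (@Rplus R) (@Rplus R) (\pi_(mring R) a)%qT.
Proof.
move=> [l al]; apply: sends_pi; first exact: measurable_itv.
move=> f _ f0 t; rewrite /Rplus/= in_itv/= andbT => t0.
have E (p : pradon R) : (\int[pr_set p]_s (f (t - s))%:E =
    \int[pr_set p]_(s in ~` `[l, 0%R]) (f (t - s))%:E)%E.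
  rewrite [RHS]integral_mkcond; apply: eq_integral => s _; rewrite patchE in_setC.
  case: ifPn => // /negPn; rewrite inE/= in_itv/= => /andP[_ s0].
  by rewrite f0// /Rplus/= in_itv/= andbT; move: s0 t0; lra.
rewrite /mr_convf /Rintegral !E.
rewrite (@eq_measure_integral _ _ _ _ (pr_set (mr_neg a))) ?subrr// => A mA AC.
by apply: al => //; apply/disjoints_subset.
Qed.

End Causality.

(** * Matrices of measures acting on vectors of functions *)

Section MatrixAction.
Context {R : realType}.
Local Notation mu := (@lebesgue_measure R).

Lemma mx_convfE n p (M : 'M[mradon R]_(n, p)) (F : 'I_p -> R -> R) i :
  mx_convf M F i = \sum_k mr_convf (M i k) (F k).
Proof. by apply/funext => t; rewrite fct_sumE. Qed.

Definition mact n p (M : 'M[mring R]_(n, p)) (F : 'I_p -> R -> R) (i : 'I_n) :=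
  \sum_k act (M i k) (F k).

Lemma Lqloc_mx_convf q n p (M : 'M[mradon R]_(n, p)) F i : 1 <= q ->
  (forall k, Lqloc q (F k)) -> Lqloc q (mx_convf M F i).
Proof.
move=> q1 VF; rewrite mx_convfE; apply: (Lqloc_sum _ q1) => k.
exact: Lqloc_mr_convf q1 (VF k).
Qed.

Lemma mx_convf_mact n p (M : 'M[mradon R]_(n, p)) F i :
  (forall k, Lqloc 1 (F k)) -> aeq (mx_convf M F i) (mact (mx_pi M) F i).
Proof.
move=> VF; rewrite mx_convfE; apply: aeq_sum => k; rewrite mxE.
exact/aeq_sym/act_pi.
Qed.

Lemma mact_aeq n p (M : 'M[mring R]_(n, p)) F G i :
  (forall k, Lqloc 1 (F k)) -> (forall k, Lqloc 1 (G k)) ->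
  (forall k, aeq (F k) (G k)) -> aeq (mact M F i) (mact M G i).
Proof. by move=> VF VG FG; apply: aeq_sum => k; exact: act_aeq. Qed.

Lemma Lqloc_mact n p (M : 'M[mring R]_(n, p)) F i :
  (forall k, Lqloc 1 (F k)) -> Lqloc 1 (mact M F i).
Proof. by move=> VF; apply: (Lqloc_sum _ (lexx _)) => k; exact: Lqloc1_act. Qed.

Lemma mactM n p r (M : 'M[mring R]_(n, p)) (N : 'M[mring R]_(p, r)) F i :
  (forall k, Lqloc 1 (F k)) ->
  aeq (mact (M *m N) F i) (mact M (mact N F) i).
Proof.
move=> VF.
apply: (@aeq_trans _ (\sum_j \sum_k act (M i k) (act (N k j) (F j)))).
  apply: aeq_sum => j; rewrite mxE; apply: aeq_trans (act_sum_l _ _ (VF j)) _.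
  by apply: aeq_sum => k; exact: actM.
rewrite exchange_big; apply: aeq_sum => k.
apply/aeq_sym/mr_convf_sum => j; exact: Lqloc1_act.
Qed.

End MatrixAction.

(** * Input functions as locally L^q functions *)

Section Omega.
Context {R : realType}.
Local Notation mu := (@lebesgue_measure R).

Lemma Lqloc_Omega (q : R) n (u : 'I_n -> R -> R) : 1 <= q -> Omega q u ->
  forall i, Lqloc q (u i).
Proof.
move=> q1 [k [Lu su]] i.
have E : u i \_ `[- k%:R, 0] = u i.
  apply/funext => t; rewrite patchE; case: ifPn => // /negP.
  by rewrite inE => /su ->.
have := Lu i; rewrite /in_Lp E => Lui.
have /sub_Lfun_mfun := Lui; rewrite inE => mu_i.
split => // [|b].
  exists (- k%:R) => t tk; apply: su; rewrite /= in_itv/= => /andP[].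
  by rewrite leNgt tk.
have /integrableP[mf] := Lfun_integrable q1 Lui.
apply: le_lt_trans; apply: (@le_trans _ _ (\int[mu]_t (`|u i t| `^ q)%:E)%E).
  by apply: ge0_subset_integral.
rewrite le_eqVlt; apply/orP; left; apply/eqP; apply: eq_integral => t _.
by rewrite gee0_abs// lee_fin powR_ge0.
Qed.

Lemma Omega_Lqloc (q T : R) n (u : 'I_n -> R -> R) : 1 <= q ->
  (forall i, Lqloc q (u i)) -> supported_in (- T) 0 u -> Omega q u.
Proof.
move=> q1 Vu su.
have q0 : 0 < q := lt_le_trans ltr01 q1.
(* [Omega] asks for a window [-k, 0] with k natural. *)
pose k := Num.bound `|T|.
have Tk : T <= k%:R by rewrite (le_trans (ler_norm T))// ltW// archi_boundP.
have su' : supported_in (- k%:R) 0 u.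
  move=> i t; rewrite /= in_itv/= => tk; apply: su; rewrite /= in_itv/=.
  by move=> /andP[Tt t0]; apply: tk; rewrite t0 andbT (le_trans _ Tt)// lerN2.
exists k; split => // i; rewrite /in_Lp.
have -> : u i \_ `[- k%:R, 0] = u i.
  apply/funext => t; rewrite patchE; case: ifPn => // /negP.
  by rewrite inE => /su' ->.
have [mf _ /(_ 0) fq] := Vu i.
apply/andP; split; rewrite inE//= /finite_norm unlock poweR_lty//.
apply: le_lt_trans fq; rewrite [leRHS]integral_mkcond.
rewrite le_eqVlt; apply/orP; left; apply/eqP; apply: eq_integral => t _.
rewrite patchE mem_setE in_itv/=; case: ifPn => //=.
rewrite -ltNge => t0; rewrite su ?normr0 ?powR0 ?gt_eqF//.
by rewrite /= in_itv/= (leNgt t) t0 andbF.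
Qed.

End Omega.

(** * Lower bound on the support of the delay matrix *)

Section DelaySupport.
Context {R : realType}.
Local Notation mu := (@lebesgue_measure R).

Lemma leadD (k : R) x y : lead k x -> lead k y -> lead k (x + y).
Proof. by move=> hx hy c; exact: sendsD. Qed.

Lemma leadN (k : R) x : lead k x -> lead k (- x).
Proof. by move=> hx c; exact: sendsN. Qed.

Lemma pr_dirac_left (k t : R) : - k <= t ->
  pr_set (pr_dirac t) `]-oo, - k[%classic = 0%E.
Proof. by move=> kt; rewrite /pr_set/= diracE memNset//= in_itv/= ltNge kt. Qed.

Lemma lead_scale_dirac (c k t : R) : - k <= t ->
  lead k (\pi_(mring R) (mr_scale c (mr_dirac t))).
Proof.
move=> kt; apply: lead_pi; rewrite /mr_scale; case: ifP => _ /=;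
  by rewrite pr_scaleE ?pr_dirac_left// mule0.
Qed.

Lemma lead_density (L : R) (f : R -> R) (hf : in_Lp +oo%E 0 L f) :
  lead 0 (\pi_(mring R) (mr_density hf)).
Proof.
by apply: lead_pi; apply: integral0_eq => x /=; rewrite oppr0 in_itv/= => x0;
  rewrite patchE memNset//= in_itv/= leNgt x0.
Qed.

(** The Dirac masses sit at -L or at -L plus a nonnegative delay, and the density lives on [0, L]
    before its translation by -L. *)
Lemma lead_delay_Q (d N : nat) (Lam : 'I_N.+1 -> R) (A : 'I_N.+1 -> 'M[R]_d)
    (g : R -> 'M[R]_d)
    (hg : forall i j, in_Lp +oo%E 0 (Lam ord_max) (fun s => g s i j)) :
  (forall k, 0 <= Lam k) ->
  forall i j, lead (Lam ord_max) (\pi_(mring R) (delay_Q A hg i j)).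
Proof.
move=> Lam0 i j; rewrite mxE /mr_sub !pi_mr_add !pi_mr_opp pi_mr_conv pi_mr_sum.
apply: leadD; [apply: leadD|].
- by rewrite mxE; exact: lead_scale_dirac.
- apply: leadN => c; apply: sends_sum => k; rewrite mxE.
  by apply: lead_scale_dirac; rewrite lerDl.
- apply: leadN; apply: (@le_lead _ (Lam ord_max + 0)); first by rewrite addr0.
  apply: leadM; last exact: lead_density.
  apply: lead_pi; last by [].
  exact: pr_dirac_left.
Qed.

End DelaySupport.

(** * Replacing an input by one supported in [-dL, 0] *)

Section InputTruncation.
Context {R : realType}.
Local Notation mu := (@lebesgue_measure R).
Variables (q : R) (d m : nat) (Q Qinv : 'M[mradon R]_d) (P : 'M[mradon R]_(d, m)).
Variable (L : R).
Hypotheses (q1 : 1 <= q) (prQ : pseudo_rational Q P Qinv).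
Hypothesis leadQ : forall i j, lead L (mx_pi Q i j).

Let q0 : 0 < q := lt_le_trans ltr01 q1.

Lemma input_truncation (u : 'I_m -> R -> R) : Omega q u ->
  exists u', [/\ Omega q u', supported_in (- (d%:R * L)) 0 u' &
    forall i, aeq (output P Qinv u' i) (output P Qinv u i)].
Proof.
move=> Ou; have [Qm Pm QiQ QQi] := prQ.
have Vu := Lqloc_Omega q1 Ou; have [k [_ su]] := Ou.
have V1 (f : R -> R) : Lqloc q f -> Lqloc 1 f by exact: Lqloc_sub1.
pose SQ := mx_pi Q; pose Si := mx_pi Qinv; pose SP := mx_pi P.
have SiQ : Si *m SQ = 1%:M by rewrite -mx_pi_conv (mx_pi_eq QiQ) mx_pi_scale1.
have SQi : SQ *m Si = 1%:M by rewrite -mx_pi_conv (mx_pi_eq QQi) mx_pi_scale1.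
pose x := \det SQ; pose y := \det Si.
have xy : x * y = 1 by rewrite -det_mulmx SQi det1.
have adjQ : \adj SQ = x *: Si.
  by rewrite -[LHS]mulmx1 -SQi mulmxA mul_adj_mx mul_scalar_mx.
have causQ i j : sends (@Rplus R) (@Rplus R) (SQ i j).
  by rewrite mxE; exact: sends_MRminus.
have causP i j : sends (@Rplus R) (@Rplus R) (SP i j).
  by rewrite mxE; exact: sends_MRminus.
pose G := Si *m SP.
(* The factor [\det Q] turns [Qinv] into [\adj Q], a polynomial in the entries of Q, which do
   preserve vanishing on R_+. *)
have causG i j : sends (@Rplus R) (@Rplus R) (G i j * x).
  have -> : G i j * x = (\adj SQ *m SP) i j.
    by rewrite adjQ -scalemxAl [RHS]mxE mulrC.
  rewrite mxE; apply: sends_sum => l; apply: sendsM; last exact: causP.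
  exact: sends_adj.
have mRp : measurable (@Rplus R) by exact: measurable_itv.
pose w j := act y (u j); pose w' j := w j \_ (@Rplus R).
have Vw j : Lqloc q (w j) by exact: Lqloc_act.
have Vw' j : Lqloc q (w' j) by exact: Lqloc_patch.
pose v j := act x (w' j).
have Vv j : Lqloc q (v j) by exact: Lqloc_act.
have ww' j : aeq_on (@Rplus R) (w j - w' j) 0.
  by apply: aeW => t Rt; rewrite !fctE /w' patchE mem_set// subrr.
(* Such a z sees only the values on R_+: apply it to the difference of w and w', which vanishes
   there. *)
have act_w z j : sends (@Rplus R) (@Rplus R) z ->
    aeq_on (@Rplus R) (act z (w' j)) (act z (w j)).
  move=> hz.
  have := hz _ (Lqloc_add (lexx _) (V1 _ (Vw j)) (Lqloc_opp (V1 _ (Vw' j)))) (ww' j).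
  apply: filterS2 (mr_convfB (repr z) (V1 _ (Vw j)) (V1 _ (Vw' j))) => t E E0 Rt.
  move: (E0 Rt); rewrite /act E !fctE => /eqP.
  by rewrite subr_eq0 eq_sym => /eqP.
have xw j : aeq (act x (w j)) (u j).
  apply: aeq_trans (act1 (V1 _ (Vu j))); rewrite -xy.
  by apply/aeq_sym; apply: actM; exact: V1.
(* The function v vanishes off this interval only almost everywhere, while [supported_in] is a
   pointwise condition. *)
pose u' j := v j \_ `[- (d%:R * L), 0]%classic.
have Vu' j : Lqloc q (u' j) by exact: Lqloc_patch q0 (measurable_itv _) (Vv j).
have su' : supported_in (- (d%:R * L)) 0 u'.
  by move=> j t tD; rewrite /u' patchE memNset.
have vu' j : aeq (v j) (u' j).
  have left_v : aeq_on `]-oo, - (d%:R * L)[%classic (v j) 0.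
    rewrite -[X in `]-oo, X[%classic]add0r.
    apply: (lead_det leadQ) => //; first exact: V1.
    apply: aeW => t; rewrite /= in_itv/= => t0.
    by rewrite /w' patchE memNset// /Rplus/= in_itv/= andbT; apply/negP; rewrite -ltNge.
  have right_v : aeq_on (@Rplus R) (v j) (u j).
    apply: aeq_on_trans (act_w x j _) (aeq_onW _ (xw j)).
    exact: sends_det.
  have n0 : {ae mu, forall t, t <> 0}.
    exists [set 0]; split; [exact: measurable_set1|exact: lebesgue_measure_set1|].
    by move=> t /= /contrapT.
  near=> t; rewrite /u' patchE; case: ifPn => // /negP; rewrite inE/= in_itv/= => tI.
  have [td|td] := ltP t (- (d%:R * L)).
    by rewrite (near left_v t).
  have t0 : 0 < t by rewrite ltNge; apply/negP => t0; apply: tI; rewrite td t0.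
  rewrite (near right_v t)//; last by rewrite /Rplus/= in_itv/= ltW.
  by rewrite su// /= in_itv/= (leNgt t) t0 andbF.
exists u'; split => //; first exact: Omega_Lqloc su'.
have outE (z : 'I_m -> R -> R) i : (forall j, Lqloc q (z j)) ->
    aeq (mx_convf Qinv (mx_convf P z) i) (mact G z i).
  move=> Vz; have Vz1 j := V1 _ (Vz j).
  apply: aeq_trans (mx_convf_mact _ _ _) _.
    by move=> j; exact: Lqloc_mx_convf.
  apply/aeq_sym; apply: aeq_trans (mactM _ _ _ Vz1) _; apply: mact_aeq.
  - by move=> j; exact: Lqloc_mact.
  - by move=> j; exact: Lqloc_mx_convf.
  - by move=> j; apply/aeq_sym; exact: mx_convf_mact.
move=> i.
have G_u' j : aeq (act (G i j) (u' j)) (act (G i j * x) (w' j)).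
  apply/aeq_sym; apply: aeq_trans (actM _ _ (V1 _ (Vw' j))) _.
  exact: act_aeq (V1 _ (Vv j)) (V1 _ (Vu' j)) (vu' j).
have G_u j : aeq (act (G i j * x) (w j)) (act (G i j) (u j)).
  apply: aeq_trans (actM _ _ (V1 _ (Vw j))) _.
  exact: act_aeq (Lqloc1_act _ (V1 _ (Vw j))) (V1 _ (Vu j)) (xw j).
(* Here u' = x w' and u = x w almost everywhere, so G x, for which [act_w] holds, acts on w' and
   w. *)
have E : aeq_on (@Rplus R) (mact G u' i) (mact G u i).
  apply: aeq_on_sum => j; apply: aeq_aeq_on (G_u' j) _.
  apply: aeq_on_trans (act_w _ _ (causG i j)) _.
  exact: aeq_onW.
have Eu' := outE _ i Vu'; have Eu := outE _ i Vu.
near=> t; rewrite /output /trunc !patchE; case: ifPn => [|//]; rewrite inE => Rt.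
by rewrite (near Eu' t)// (near Eu t)// (near E t).
Unshelve. all: by end_near. Qed.

End InputTruncation.

(** * From input truncation to reachability times *)

Section ReachabilityTimes.
Context {R : realType}.
Local Notation mu := (@lebesgue_measure R).

Lemma supported_inS (a a' b : R) n (u : 'I_n -> R -> R) : a' <= a ->
  supported_in a b u -> supported_in a' b u.
Proof.
move=> aa su i t tI; apply: su => tI'; apply: tI.
by move: tI'; rewrite /= !in_itv/= => /andP[at_ ->]; rewrite andbT (le_trans aa).
Qed.

Lemma measurable_output (q : R) d m (P : 'M[mradon R]_(d, m)) (Qinv : 'M[mradon R]_d)
    (u : 'I_m -> R -> R) i : 1 <= q -> Omega q u ->
  measurable_fun setT (output P Qinv u i).
Proof.
move=> q1 Ou; apply/(measurable_restrictT _ _).1; first exact: measurable_itv.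
apply: measurable_funTS.
have [] // : Lqloc q (mx_convf Qinv (mx_convf P u) i).
by do 2 apply: Lqloc_mx_convf => // ?; exact: Lqloc_Omega.
Qed.

(** The L^q seminorms ignore null sets; measurability serves to compare the integrals of functions
    that agree almost everywhere. *)
Lemma eq_Gamma_cvg (q : R) n (z z' : nat -> 'I_n -> R -> R) (y : 'I_n -> R -> R) :
  (forall k i, measurable_fun setT (z k i)) ->
  (forall k i, measurable_fun setT (z' k i)) -> Gamma q y ->
  (forall k i, aeq (z' k i) (z k i)) -> Gamma_cvg q z y -> Gamma_cvg q z' y.
Proof.
move=> mz mz' Gy zz zy i T T0.
have mI : measurable `[0, T]%classic by exact: measurable_itv.
have my : measurable_fun `[0, T] (y i).
  by have /sub_Lfun_mfun := Gy i T T0; rewrite inE => /(measurable_restrictT _ mI).2.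
have mzy (f : R -> R) : measurable_fun setT f ->
    measurable_fun setT (fun t => (`|((f \- y i) \_ `[0, T]) t| `^ q)%:E).
  move=> mf; apply/measurable_EFinP; apply: measurable_normr_powR.
  exact ((measurable_restrictT (f \- y i) mI).1
    (measurable_funB (measurable_funTS mf) my)).
have := zy i T T0; rewrite (_ : (fun k => _) = (fun k =>
  Lnorm mu q%:E (EFin \o ((z' k i \- y i) \_ `[0, T]))))//.
apply/funext => k; rewrite unlock; apply: (congr1 (poweR ^~ q^-1)).
apply: ae_eq_integral => //; [exact: (mzy _ (mz k i))|exact: (mzy _ (mz' k i))|].
apply: filterS (zz k i) => t E _; rewrite /= !patchE.
by case: ifP => // _ /=; rewrite E.
Qed.

Variables (q : R) (d m : nat) (Q Qinv : 'M[mradon R]_d) (P : 'M[mradon R]_(d, m)).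
Variable (L : R).
Hypotheses (q1 : 1 <= q) (prQ : pseudo_rational Q P Qinv).
Hypothesis leadQ : forall i j, lead L (mx_pi Q i j).

Lemma reachable_in_ge (T : R) : d%:R * L <= T -> reachable Q P Qinv q ->
  reachable_in Q P Qinv q T.
Proof.
move=> dT rQ y Xy; have [u [Ou uy]] := rQ y Xy.
have [u' [Ou' su' u'u]] := input_truncation q1 prQ leadQ Ou.
exists u'; split; [exact: Ou'|by apply: supported_inS su'; rewrite lerN2|move=> i].
by apply: filterS2 (u'u i) (uy i) => t ->.
Qed.

(** Truncation leaves each output unchanged almost everywhere, so the given sequence is truncated
    term by term and no limit of inputs is taken. *)
Lemma quasi_reachable_in_ge (T : R) : d%:R * L <= T -> quasi_reachable Q P Qinv q ->
  quasi_reachable_in Q P Qinv q T.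
Proof.
move=> dT rQ y Xy; have [u_ [Ou uy]] := rQ y Xy.
have /choice[v_ hv] := fun k => input_truncation q1 prQ leadQ (Ou k).
exists v_; split => [k|].
  by have [Ov sv _] := hv k; split => //; apply: supported_inS sv; rewrite lerN2.
apply: eq_Gamma_cvg uy.
- by move=> k i; exact: measurable_output (Ou k).
- by move=> k i; have [Ov _ _] := hv k; exact: measurable_output Ov.
- by have [] := Xy.
- by move=> k; have [] := hv k.
Qed.

Lemma reachable_in_reachable (T : R) : reachable_in Q P Qinv q T ->
  reachable Q P Qinv q.
Proof. by move=> rQ y /rQ[u [Ou _ uy]]; exists u. Qed.

Lemma quasi_reachable_in_quasi_reachable (T : R) :
  quasi_reachable_in Q P Qinv q T -> quasi_reachable Q P Qinv q.
Proof. by move=> rQ y /rQ[u [Ou uy]]; exists u; split => // k; have [] := Ou k. Qed.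

End ReachabilityTimes.

Theorem theorem6p1 (R : realType) (q : R) (hq : 1 <= q)
    (d m N : nat) (hd : (0 < d)%N) (hm : (0 < m)%N)
    (Lam : 'I_N.+1 -> R) (hLam0 : 0 < Lam ord0)
    (hLam : forall k l : 'I_N.+1, (k < l)%N -> Lam k < Lam l)
    (A : 'I_N.+1 -> 'M[R]_d) (B : 'M[R]_(d, m)) (g : R -> 'M[R]_d)
    (hg : forall i j, in_Lp +oo%E 0 (Lam ord_max) (fun s => g s i j))
    (Qinv : 'M[mradon R]_d) :
  let Q := delay_Q A hg in
  let P := delay_P B in
  pseudo_rational Q P Qinv ->
  [/\ quasi_reachable Q P Qinv q <->
        (forall T : R, d%:R * Lam ord_max < T -> quasi_reachable_in Q P Qinv q T),
      reachable Q P Qinv q <->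
        (forall T : R, d%:R * Lam ord_max < T -> reachable_in Q P Qinv q T),
      quasi_reachable Q P Qinv q ->
        (Tmin_qr Q P Qinv q <= (d%:R * Lam ord_max)%:E)%E &
      reachable Q P Qinv q ->
        (Tmin_r Q P Qinv q <= (d%:R * Lam ord_max)%:E)%E ].
Proof.
move=> Q P prQ; set L := Lam ord_max.
have Lam_gt0 k : 0 < Lam k.
  have [->//|k0] := eqVneq k ord0.
  by rewrite (lt_trans hLam0)// hLam// lt0n.
(* The minimal times are infima over positive T, so dL must be positive to be a candidate. *)
have dL : 0 < d%:R * L by rewrite mulr_gt0 ?ltr0n //; exact: Lam_gt0.
have leadQ i j : lead L (mx_pi Q i j).
  by rewrite mxE; apply: lead_delay_Q => k; exact: ltW.
have T1 : d%:R * L < d%:R * L + 1 by rewrite ltrDl.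
split.
- split=> [rQ T /ltW|/(_ _ T1)].
    by move/(quasi_reachable_in_ge hq prQ leadQ); apply.
  exact: quasi_reachable_in_quasi_reachable.
- split=> [rQ T /ltW|/(_ _ T1)].
    by move/(reachable_in_ge hq prQ leadQ); apply.
  exact: reachable_in_reachable.
(* The time dL is itself admissible, hence belongs to the set whose infimum is taken. *)
- move=> /(quasi_reachable_in_ge hq prQ leadQ (lexx _)) rQ.
  by apply: ereal_inf_lbound; exists (d%:R * L).
- move=> /(reachable_in_ge hq prQ leadQ (lexx _)) rQ.
  by apply: ereal_inf_lbound; exists (d%:R * L).
Qed.
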